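(* Let $m$ be a positive integer, $n\in\mathbb N$, let $\mathcal{T}_1,\mathcal{T}_2,\dots$ be operators in $\mathbb A$, and let $\beta_j\in\mathbb N_0$, $\alpha_l\in\mathbb N_0$. Then $\tilde H^m_{\kappa,0}(I)$ is closed under the operator $\sum_{l=1}^n\prod_{j=1}^{\alpha_l}\mathcal{T}_j^{\beta_j}$, i.e. this operator maps $\tilde H^m_{\kappa,0}(I)$ into itself.
   Context: $I=[-1,1]$; $\kappa\in(1,\infty)$; functions are complex-valued. A $\kappa$-parameterized function is a family $u=(u_\kappa)_{\kappa>1}$; operators depending on $\kappa$ act $\kappa$-wise. $H^m(I)$ is the Sobolev space with $\|u\|_{H^m}=(\sum_{j=0}^m\|u^{(j)}\|_{L^2(I)}^2)^{1/2}$. $H^m_{\kappa,0}(I)$: $\kappa$-parameterized $u$ with $u\in H^m(I)$ for every $\kappa$ and constants $c,\kappa_0>0$ with $\|u\|_{H^m}\le c$ for $\kappa\ge\kappa_0$. $\tilde H^m_{\kappa,0}(I)=\{u_0+u_1e^{i\kappa t}+u_2e^{-i\kappa t}:u_j\in H^m_{\kappa,0}(I)\}$. $C^{[m]}(I^2)$: functions on $I^2$ with continuous $\partial_s^\alpha\partial_t^\beta L$ for $\alpha,\beta\le m$, $\|L\|_{C^{[m]}}=\max_{\alpha,\beta\le m}\|\partial_s^\alpha\partial_t^\beta L\|_\infty$; $C^{[m]}_{\kappa,0}(I^2)$: $\kappa$-parameterized $L\in C^{[m]}(I^2)$ with $\|L\|_{C^{[m]}}\le c$ for all $\kappa\ge\kappa_0$,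 for some $c,\kappa_0>0$. For $L_1,L_2\in C(I^2)$, $\epsilon\in\{0,1\}$: $(\mathcal{A}_\epsilon[L_1,L_2]u)(s)=\int_{-1}^sL_1(s,t)e^{i\kappa(s-t)}u(t)dt+(-1)^\epsilon\int_s^1L_2(s,t)e^{i\kappa(t-s)}u(t)dt$. $\mathbb A=\{\mathcal{A}_\epsilon[L_1,L_2]:\epsilon\in\{0,1\},\ L_1,L_2\in C^{[m]}_{\kappa,0}(I^2)\}$. *)

(* Defs.v *)
From mathcomp Require Import all_boot all_order all_algebra.
From mathcomp Require Import all_classical all_reals all_analysis.
Set Implicit Arguments. Unset Strict Implicit. Unset Printing Implicit Defensive.
Import Order.TTheory GRing.Theory Num.Theory.
Import numFieldNormedType.Exports.
Local Open Scope classical_set_scope.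
Local Open Scope ring_scope.

Section Defs.
Variable R : realType.

Definition cplx := (R * R)%type.
Definition cmul (z w : cplx) : cplx := (z.1 * w.1 - z.2 * w.2, z.1 * w.2 + z.2 * w.1).
Definition cexpi (theta : R) : cplx := (cos theta, sin theta).
Definition cabs2 (z : cplx) : R := z.1 ^+ 2 + z.2 ^+ 2.
Definition cabs (z : cplx) : R := Num.sqrt (cabs2 z).

Definition mu := (@lebesgue_measure R).

Definition I : set R := `[-1, 1].
Definition Io : set R := `]-1, 1[.

Definition cint (D : set R) (f : R -> cplx) : cplx :=
  (Rintegral mu D (fun t => (f t).1), Rintegral mu D (fun t => (f t).2)).

Definition L2 (f : R -> cplx) : Prop :=
  measurable_fun I (fun t => (f t).1) /\ measurable_fun I (fun t => (f t).2) /\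
  mu.-integrable I (fun t => (cabs2 (f t))%:E).
Definition L2sq (f : R -> cplx) : R := Rintegral mu I (fun t => cabs2 (f t)).

Definition test_fun (phi : R -> R) : Prop :=
  (forall n x, derivable (derive1n n phi) x 1) /\
  exists a b, -1 < a /\ b < 1 /\ forall x, (x < a \/ b < x) -> phi x = 0.

Definition weak_deriv (u v : R -> cplx) : Prop :=
  forall phi, test_fun phi ->
    cint I (fun t => (derive1 phi t) *: u t) = - cint I (fun t => phi t *: v t).

Definition Hm_le (m : nat) (u : R -> cplx) (c : R) : Prop :=
  exists v : nat -> R -> cplx,
    (forall t, I t -> v 0%N t = u t) /\
    (forall j, (j <= m)%N -> L2 (v j)) /\
    (forall j, (j < m)%N -> weak_deriv (v j) (v j.+1)) /\
    Num.sqrt (\sum_(j < m.+1) L2sq (v j)) <= c.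

Definition inHm (m : nat) (u : R -> cplx) : Prop := exists c, Hm_le m u c.

(* kappa-parameterized functions: u kappa t *)
Definition kfun := R -> R -> cplx.

Definition Hk0 (m : nat) (u : kfun) : Prop :=
  (forall k, 1 < k -> inHm m (u k)) /\
  exists c k0, 0 < c /\ 0 < k0 /\ forall k, 1 < k -> k0 <= k -> Hm_le m (u k) c.

Definition tHk0 (m : nat) (u : kfun) : Prop :=
  exists u0 u1 u2, Hk0 m u0 /\ Hk0 m u1 /\ Hk0 m u2 /\
    forall k t, 1 < k -> I t ->
      u k t = u0 k t + cmul (u1 k t) (cexpi (k * t)) + cmul (u2 k t) (cexpi (- (k * t))).

(* C^{[m]}(I^2) with ||L||_{C^{[m]}} <= c : D a b = d_s^a d_t^b L, derivatives
   taken in the interior of I^2 and extending continuously to I^2 *)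
Definition Cm_le (m : nat) (L : R -> R -> cplx) (c : R) : Prop :=
  exists D : nat -> nat -> R -> R -> cplx,
    (forall s t, I s -> I t -> D 0%N 0%N s t = L s t) /\
    (forall a b, (a <= m)%N -> (b <= m)%N ->
       {within I `*` I, continuous (fun p : R * R => D a b p.1 p.2)}) /\
    (forall b, (b < m)%N -> forall s t, Io s -> Io t ->
       is_derive t 1 (D 0%N b s) (D 0%N b.+1 s t)) /\
    (forall a b, (a < m)%N -> (b <= m)%N -> forall s t, Io s -> Io t ->
       is_derive s 1 (fun s' => D a b s' t) (D a.+1 b s t)) /\
    (forall a b s t, (a <= m)%N -> (b <= m)%N -> I s -> I t -> cabs (D a b s t) <= c).

(* kappa-parameterized kernels: L kappa s t *)
Definition kker := R -> R -> R -> cplx.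

Definition Ck0 (m : nat) (L : kker) : Prop :=
  (forall k, 1 < k -> exists c, Cm_le m (L k) c) /\
  exists c k0, 0 < c /\ 0 < k0 /\ forall k, 1 < k -> k0 <= k -> Cm_le m (L k) c.

(* the operator A_eps[L1,L2] (eps = false means epsilon = 0, true means 1) *)
Definition opA (eps : bool) (L1 L2 : kker) (u : kfun) : kfun :=
  fun k s =>
    cint `[-1, s] (fun t => cmul (L1 k s t) (cmul (cexpi (k * (s - t))) (u k t)))
    + ((-1) ^+ eps) *: cint `[s, 1] (fun t => cmul (L2 k s t) (cmul (cexpi (k * (t - s))) (u k t))).

Definition opdata := (bool * kker * kker)%type.
Definition inA (m : nat) (o : opdata) : Prop := Ck0 m o.1.2 /\ Ck0 m o.2.
Definition opT (o : opdata) : kfun -> kfun := opA o.1.1 o.1.2 o.2.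

Definition prodop (T : nat -> opdata) (beta : nat -> nat) (a : nat) : kfun -> kfun :=
  foldr (fun j acc => fun u => iter (beta j) (opT (T j)) (acc u)) id (iota 1 a).

Definition sumop (T : nat -> opdata) (beta alpha : nat -> nat) (n : nat) : kfun -> kfun :=
  fun u k s => \sum_(1 <= l < n.+1) prodop T beta (alpha l) u k s.

End Defs.

(* Main.v *)
Require Import Defs.
From mathcomp Require Import all_boot all_order all_algebra.
From mathcomp Require Import all_classical all_reals all_analysis.
From mathcomp Require Import measurable_realfun ring lra zify.
Set Implicit Arguments. Unset Strict Implicit. Unset Printing Implicit Defensive.
Import Order.TTheory GRing.Theory Num.Theory.
Import numFieldNormedType.Exports.
Local Open Scope classical_set_scope.
Local Open Scope ring_scope.

(** Induction over sums, products and powers reduces the claim to a single operator of $\mathbb A$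
    ([tHk0_opT]). By linearity the input may be one wave $e^{i\sigma\kappa t}u(t)$ with
    $\sigma\in\{0,1,-1\}$ and $u$ bounded in $H^m$. Pulling $e^{i\sigma\kappa s}$ out of the first
    integral leaves $\int_{-1}^s e^{i\omega(s-t)}L(s,t)u(t)\,dt$ with $\omega=(1-\sigma)\kappa$. The
    integral over $[s,1]$ is the integral over all of $I$, which is $e^{-i\kappa s}$ times a
    function smooth in $s$ ([ctower_full]), minus an integral over $[-1,s]$ of the same shape with
    $\omega=(-1-\sigma)\kappa$. Since $\kappa>1$, either $\omega=0$ or $|\omega|\ge1$.

    The key point concerns $Vf(s)=\int_{-1}^s\theta(s-t)f(s,t)\,dt$. As
    $(\partial_s+\partial_t)\theta(s-t)=0$, its derivative is
    $V(\partial_sf+\partial_tf)+\theta(s+1)f(s,-1)$: no $\theta'$ appears, hence no factor $\omega$,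
    and only the boundary term would produce one at the next differentiation. Adding
    $\sum_j\zeta_j(s)\,\partial_t^jf(s,-1)$, where $\zeta_0'=-\theta(s+1)$ and
    $\zeta_{j+1}'=\zeta_j$, cancels that term at every order ([AC_corrected]), so the corrected
    function has $m$ derivatives bounded independently of $\theta'$ ([tower_corrected]). For cosines
    and sines the $\zeta_j$ are $\omega^{-j-1}$ times phase-shifted cosines ([volterra_cos]), so the
    correction is a bounded smooth amplitude times $e^{i\omega s}$; for $\omega=0$ the $\zeta_j$ are
    polynomials and the correction is itself smooth ([volterra_const]). Thus the integral is
    $w(s)+b(s)e^{i\omega s}$ with bounds uniform in $\omega$ ([decomp_volterra_exp]), and
    multiplying back by $e^{i\sigma\kappa s}$ only yields the frequencies $0,\pm\kappa$
    ([waves_shift]).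

    The rest connects this calculus with the definitions. Absolute continuity is treated as being an
    indefinite Lebesgue integral, with a product rule obtained from Fubini ([AC_mul]). Weak
    derivatives are turned into such integrals by the du Bois-Reymond lemma ([du_bois_reymond],
    [source_of_Hm]), and bounded towers of absolutely continuous functions lie in $H^m$
    ([Hm_of_ctower]). Kernels differentiable inside the square yield integral identities up to the
    boundary ([kernel_of_Cm]). Every constant depends only on $m$ and on the bounds for the kernels
    and the function, which gives uniformity for large $\kappa$. *)

(** * Integrals on $[-1,1]$ and absolutely continuous functions *)

Section AbsolutelyContinuous.
Variable R : realType.
Local Notation mu := (@lebesgue_measure R).
Local Notation J := (`[(-1 : R), 1]%classic).
Implicit Types (f g F G : R -> R) (a b c s t x y : R).

Definition itg a b f : R := \int[mu]_(t in `[a, b]) f t.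
Definition integ f : Prop := mu.-integrable J (EFin \o f).
Definition inJ x : Prop := -1 <= x /\ x <= 1.

Lemma inJE x : J x <-> inJ x.
Proof. by rewrite /= in_itv /=; split => [/andP[]|[-> ->]]. Qed.

Lemma inJN1 : inJ (-1).  Proof. by split; lra. Qed.
Lemma inJ1 : inJ 1. Proof. by split; lra. Qed.

Lemma measurableJ : measurable (J : set (measurableTypeR R)). Proof. exact: measurable_itv. Qed.

Lemma muJ : (mu J < +oo)%E.
Proof. by rewrite lebesgue_measure_itv /= lte_fin; case: ifP => // _; rewrite ltry. Qed.

Lemma integ_sub f a b : inJ a -> inJ b -> integ f ->
  mu.-integrable `[a, b] (EFin \o f).
Proof.
move=> [a1 a2] [b1 b2]; apply: integrableS => //.
by apply: subset_itv; rewrite bnd_simp.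
Qed.

Lemma integ_ext f g : (forall x, inJ x -> f x = g x) -> integ f -> integ g.
Proof.
move=> fg; apply: eq_integrable => // x; rewrite inE => /inJE Jx /=.
by rewrite fg.
Qed.

Lemma integD f g : integ f -> integ g -> integ (fun x => f x + g x).
Proof.
move=> intf intg; rewrite /integ.
have := integrableD measurableJ intf intg; apply: eq_integrable => //.
Qed.

Lemma integZ (c : R) f : integ f -> integ (fun x => c * f x).
Proof.
move=> intf; rewrite /integ.
have := integrableZl measurableJ c intf; apply: eq_integrable => //.
Qed.

Lemma integN f : integ f -> integ (fun x => - f x).
Proof. by move=> /(integZ (-1)); apply: integ_ext => x _; rewrite mulN1r. Qed.

Lemma integB f g : integ f -> integ g -> integ (fun x => f x - g x).
Proof. by move=> intf /integN; exact: integD. Qed.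

Lemma integ_bnd f (C : R) : measurable_fun J f -> (forall x, inJ x -> `|f x| <= C) ->
  integ f.
Proof.
move=> mf fC; apply: measurable_bounded_integrable => //; first exact: muJ.
exists C; split; first exact: num_real.
by move=> M CM x /inJE Jx; apply: le_trans (fC _ Jx) (ltW CM).
Qed.

Lemma integ_cst c : integ (fun=> c).
Proof. by apply: (@integ_bnd _ `|c|). Qed.

Lemma integ_measurable f : integ f -> measurable_fun J f.
Proof. by move=> /integrableP[] /measurable_EFinP. Qed.

Lemma integ_mul_bnd f g (C : R) : measurable_fun J g ->
  (forall x, inJ x -> `|g x| <= C) -> integ f -> integ (fun x => g x * f x).
Proof.
move=> mg gC intf; rewrite /integ.
have bg : [bounded g x | x in J].
  exists C; split; first exact: num_real.
  by move=> M CM x /inJE Jx; apply: le_trans (gC _ Jx) (ltW CM).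
have := integrableMr measurableJ mg bg intf; apply: eq_integrable => //.
Qed.

Lemma integ_norm f : integ f -> integ (fun x => `|f x|).
Proof. exact: integrable_norm. Qed.

Lemma eq_itg a b f g : (forall x, a <= x <= b -> f x = g x) -> itg a b f = itg a b g.
Proof. by move=> fg; apply: eq_Rintegral => x; rewrite inE /= in_itv /=; exact: fg. Qed.

Lemma itgD a b f g : inJ a -> inJ b -> integ f -> integ g ->
  itg a b (fun x => f x + g x) = itg a b f + itg a b g.
Proof. by move=> Ja Jb intf intg; apply: RintegralD => //; exact: integ_sub. Qed.

Lemma itgZ a b c f : inJ a -> inJ b -> integ f ->
  itg a b (fun x => c * f x) = c * itg a b f.
Proof. by move=> Ja Jb intf; apply: RintegralZl => //; exact: integ_sub. Qed.

Lemma itgN a b f : inJ a -> inJ b -> integ f ->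
  itg a b (fun x => - f x) = - itg a b f.
Proof.
move=> Ja Jb intf; rewrite -mulN1r -itgZ //.
by apply: eq_itg => x _; rewrite mulN1r.
Qed.

Lemma itgB a b f g : inJ a -> inJ b -> integ f -> integ g ->
  itg a b (fun x => f x - g x) = itg a b f - itg a b g.
Proof. by move=> Ja Jb intf intg; rewrite itgD ?itgN //; exact: integN. Qed.

Lemma itg_cst a b c : a <= b -> itg a b (fun=> c) = c * (b - a).
Proof.
move=> ab; rewrite /itg Rintegral_cst //; congr (_ * _).
transitivity (fine (mu `[a, b]%classic)); first by [].
rewrite lebesgue_measure_itv /= lte_fin.
by case: ltP => //= ba; rewrite (_ : b = a) ?subrr //; apply/le_anti/andP.
Qed.

Lemma itgxx a f : itg a a f = 0.
Proof. by rewrite /itg set_itv1 Rintegral_set1. Qed.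

Lemma itg_split a b c f : inJ a -> inJ c -> a <= b <= c -> integ f ->
  itg a c f = itg a b f + itg b c f.
Proof.
move=> Ja Jc /andP[ab bc] intf.
have intac : mu.-integrable `[a, c] (EFin \o f) by apply: integ_sub.
have := @Rintegral_itvB R f (BLeft a) (BRight c) b intac.
rewrite !bnd_simp => /(_ ab bc); rewrite /itg => H.
have intbc : mu.-integrable `]b, c] (EFin \o f).
  by apply: integrableS intac => //; apply: subset_itv; rewrite bnd_simp.
by rewrite -(Rintegral_itv_obnd_cbnd intbc) -H addrC subrK.
Qed.

Lemma le_itg a b f g : inJ a -> inJ b -> integ f -> integ g ->
  (forall x, a <= x <= b -> f x <= g x) -> itg a b f <= itg a b g.
Proof.
move=> Ja Jb intf intg fg; by apply: le_Rintegral => //; exact: integ_sub.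
Qed.

Lemma itg_ge0 a b f : (forall x, a <= x <= b -> 0 <= f x) -> 0 <= itg a b f.
Proof. by move=> f0; apply: Rintegral_ge0 => x; rewrite /= in_itv /=; exact: f0. Qed.

Lemma norm_itg a b f : inJ a -> inJ b -> a <= b -> integ f ->
  `|itg a b f| <= itg a b (fun x => `|f x|).
Proof. by move=> Ja Jb ab intf; apply: le_normr_Rintegral => //; exact: integ_sub. Qed.

Lemma itg_le_full a b f : inJ a -> inJ b -> a <= b -> integ f -> (forall x, inJ x -> 0 <= f x) ->
  itg a b f <= itg (-1) 1 f.
Proof.
move=> Ja Jb ab intf f0; have [[a1 a2] [b1 b2]] := (Ja, Jb).
rewrite (@itg_split (-1) a 1) ?(inJN1, inJ1) // ?a1 //.
rewrite (@itg_split a b 1) ?inJ1 // ?ab //.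
have A0 : 0 <= itg (-1) a f.
  by apply: itg_ge0 => x /andP[xa xb]; apply: f0; split => //; lra.
have B0 : 0 <= itg b 1 f.
  by apply: itg_ge0 => x /andP[xa xb]; apply: f0; split => //; lra.
lra.
Qed.

Lemma norm_itg_le a b f g : inJ a -> inJ b -> a <= b -> integ f -> integ g ->
  (forall x, inJ x -> `|f x| <= g x) -> `|itg a b f| <= itg (-1) 1 g.
Proof.
move=> Ja Jb ab intf intg fg; have [[a1 a2] [b1 b2]] := (Ja, Jb).
apply: (le_trans (norm_itg Ja Jb ab intf)).
apply: (@le_trans _ _ (itg a b g)).
  apply: le_itg => //; first exact: integ_norm.
  by move=> x /andP[ax xb]; apply: fg; split; lra.
by apply: itg_le_full => // x Jx; apply: le_trans (fg x Jx).
Qed.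

(** Absolute continuity with density [f], stated as an integral identity at every point; no
    derivative is taken almost everywhere, and [f] is only determined up to a null set. *)
Definition AC F f : Prop :=
  integ f /\ forall s, inJ s -> F s = F (-1) + itg (-1) s f.

Lemma AC_itg F f s t : AC F f -> inJ s -> inJ t -> s <= t -> F t = F s + itg s t f.
Proof.
move=> [intf Ff] Js Jt st; rewrite (Ff t) // (Ff s) // -addrA; congr (_ + _).
have st' : -1 <= s <= t by case: Js => -> _.
exact: itg_split inJN1 Jt st' intf.
Qed.

Lemma AC_ext F f G g : (forall x, inJ x -> F x = G x) ->
  (forall x, inJ x -> f x = g x) -> AC F f -> AC G g.
Proof.
move=> FG fg [intf Ff]; split; first exact: integ_ext intf.
move=> s Js; rewrite -(FG _ Js) -(FG _ inJN1).
rewrite Ff //; congr (_ + _); apply: eq_itg => x /andP[x1 xs].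
by apply: fg; case: Js => _ ?; split; lra.
Qed.

Lemma ACD F f G g : AC F f -> AC G g ->
  AC (fun x => F x + G x) (fun x => f x + g x).
Proof.
move=> [intf Ff] [intg Gg]; split; first exact: integD.
by move=> s Js; rewrite itgD ?inJN1 // Ff // Gg //; ring.
Qed.

Lemma ACZ c F f : AC F f -> AC (fun x => c * F x) (fun x => c * f x).
Proof.
move=> [intf Ff]; split; first exact: integZ.
by move=> s Js; rewrite itgZ ?inJN1 // Ff //; ring.
Qed.

Lemma AC_cst c : AC (fun=> c) (fun=> 0).
Proof.
split; first exact: integ_cst.
by move=> s [s1 s2]; rewrite itg_cst // mul0r addr0.
Qed.

Lemma ACN F f : AC F f -> AC (fun x => - F x) (fun x => - f x).
Proof. by move=> /(ACZ (-1)); apply: AC_ext => x _; rewrite mulN1r. Qed.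

Lemma ACB F f G g : AC F f -> AC G g ->
  AC (fun x => F x - G x) (fun x => f x - g x).
Proof. by move=> ACF /ACN; exact: ACD. Qed.

Lemma AC_sum n (F f : nat -> R -> R) : (forall j, (j < n)%N -> AC (F j) (f j)) ->
  AC (fun x => \sum_(j < n) F j x) (fun x => \sum_(j < n) f j x).
Proof.
elim: n => [|n IHn] ACF.
  by apply: AC_ext (AC_cst 0) => x _; rewrite big_ord0.
have := ACD (IHn (fun j jn => ACF j (ltnW jn))) (ACF n (ltnSn n)).
by apply: AC_ext => x _; rewrite big_ord_recr.
Qed.

Lemma AC_continuous F f : AC F f -> {within J, continuous F}.
Proof.
move=> [intf Ff].
have N11 : (-1 : R) <= 1 by lra.
have cint := @parameterized_integral_continuous R _ _ _ N11 intf.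
have cG : {within J, continuous (fun x => F (-1) + itg (-1) x f)}.
  by move=> x; apply: cvgD; [exact: cvg_cst|exact: cint].
apply: (subspace_eq_continuous _ cG) => x; rewrite inE => /inJE Jx.
exact/esym/Ff.
Qed.

Lemma AC_measurable F f : AC F f -> measurable_fun J F.
Proof. by move=> /AC_continuous; exact: subspace_continuous_measurable_fun. Qed.

Lemma AC_integ F f : AC F f -> integ F.
Proof.
move=> /AC_continuous; apply: continuous_compact_integrable.
exact: segment_compact.
Qed.

Lemma AC_bounded F f : AC F f -> exists C, forall x, inJ x -> `|F x| <= C.
Proof.
move=> [intf Ff]; exists (`|F (-1)| + itg (-1) 1 (fun x => `|f x|)) => x Jx.
rewrite Ff //; apply: (le_trans (ler_normD _ _)); rewrite lerD2l.
by apply: norm_itg_le (inJN1) Jx (proj1 Jx) intf (integ_norm intf) _ => y _.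
Qed.

Lemma AC_integ_mul F f g : AC F f -> integ g -> integ (fun x => F x * g x).
Proof.
move=> ACF; have [C FC] := AC_bounded ACF.
exact: integ_mul_bnd (AC_measurable ACF) FC.
Qed.

End AbsolutelyContinuous.

(** * Fubini on the square and on triangles; the product rule *)

Section Fubini.
Variable R : realType.
Local Notation mu := (@lebesgue_measure R).
Local Notation J := (`[(-1 : R), 1]%classic).
Local Notation RR := (measurableTypeR R * measurableTypeR R)%type.
Local Notation JJ := (J `*` J : set RR).
Implicit Types (p g F G : R -> R) (f h : R -> R -> R) (a b c s t x y : R).

(** Integrability of the sections is demanded at every point, not almost every one, so that iterated
    integrals can be manipulated pointwise. *)
Definition jint f : Prop :=
  [/\ (mu \x mu)%E.-integrable (JJ) (fun z : RR => (f z.1 z.2)%:E),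
      forall x, inJ x -> integ (f x) & forall y, inJ y -> integ (f^~ y)].

Definition jmeas h (C : R) : Prop :=
  measurable_fun (JJ) (fun z : RR => h z.1 z.2) /\
  forall x y, inJ x -> inJ y -> `|h x y| <= C.

Lemma measurableJJ : measurable (JJ).
Proof. by apply: measurableX; exact: measurableJ. Qed.

Lemma mem_JJ x y : (((x, y) : RR) \in JJ) = (x \in J) && (y \in J).
Proof. by apply/idP/andP => [|[]]; rewrite !inE => // -[]. Qed.

Lemma jint_ext f h : (forall x y, inJ x -> inJ y -> f x y = h x y) -> jint f -> jint h.
Proof.
move=> fh [i1 i2 i3]; split.
- apply: eq_integrable i1; first exact: measurableJJ.
  by move=> z; rewrite inE => -[/= /inJE z1 /inJE z2]; rewrite fh.
- by move=> x Jx; apply: integ_ext (i2 x Jx) => y Jy; exact: fh.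
- by move=> y Jy; apply: integ_ext (i3 y Jy) => x Jx; exact: fh.
Qed.

Lemma jintD f h : jint f -> jint h -> jint (fun x y => f x y + h x y).
Proof.
move=> [i1 i2 i3] [j1 j2 j3]; split.
- by have := integrableD measurableJJ i1 j1; apply: eq_integrable => //; exact: measurableJJ.
- by move=> x Jx; apply: integD; auto.
- by move=> y Jy; apply: integD; auto.
Qed.

Lemma jmeas_section h C x : jmeas h C -> inJ x -> measurable_fun J (h x).
Proof.
move=> [mh _] Jx.
have -> : h x = (fun z : RR => h z.1 z.2) \o (pair x : measurableTypeR R -> RR) by [].
apply: measurable_comp mh _; first exact: measurableJJ.
- by move=> _ /= [y Jy <-]; split => //=; exact/inJE.
- by apply: measurable_funTS; exact: measurable_pair1.
Qed.

Lemma jmeas_section2 h C y : jmeas h C -> inJ y -> measurable_fun J (h^~ y).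
Proof.
move=> [mh _] Jy.
have -> : h^~ y = (fun z : RR => h z.1 z.2) \o (fun x : measurableTypeR R => (x, y) : RR) by [].
apply: measurable_comp mh _; first exact: measurableJJ.
- by move=> _ /= [x Jx <-]; split => //=; exact/inJE.
- by apply: measurable_funTS; exact: measurable_pair2.
Qed.

Lemma jint_mul f h C : jmeas h C -> jint f -> jint (fun x y => h x y * f x y).
Proof.
move=> jh [i1 i2 i3]; have [mh hC] := jh; split.
- have bh : [bounded h z.1 z.2 | z in JJ].
    exists C; split; first exact: num_real.
    move=> M CM z [/= /inJE z1 /inJE z2].
    by apply: le_trans (hC _ _ z1 z2) (ltW CM).
  have := integrableMr measurableJJ mh bh i1; apply: eq_integrable => //.
  exact: measurableJJ.
- move=> x Jx; apply: (@integ_mul_bnd _ _ _ C); last exact: i2.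
    exact: jmeas_section jh Jx.
  by move=> y Jy; exact: hC.
- move=> y Jy; apply: (@integ_mul_bnd _ _ _ C); last exact: i3.
    exact: jmeas_section2 jh Jy.
  by move=> x Jx; exact: hC.
Qed.

(** Tonelli: after extension by zero to the line, the double integral of the absolute value factors
    into two finite integrals. *)
Lemma jint_prod p g : integ p -> integ g -> jint (fun x y => p x * g y).
Proof.
move=> ip ig; split; last 2 first.
- by move=> x _; exact: integZ.
- by move=> y _; apply: integ_ext (integZ (g y) ip) => x _; rewrite mulrC.
pose P := p \_ J; pose Q := g \_ J.
have iP : mu.-integrable setT (EFin \o P).
  by rewrite /P -restrict_EFin; apply/(integrable_mkcond _ _).1 => //; exact: measurableJ.
have iQ : mu.-integrable setT (EFin \o Q).
  by rewrite /Q -restrict_EFin; apply/(integrable_mkcond _ _).1 => //; exact: measurableJ.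
have mP : measurable_fun setT P by case/integrableP : iP => /measurable_EFinP.
have mQ : measurable_fun setT Q by case/integrableP : iQ => /measurable_EFinP.
have mPQ : measurable_fun setT (fun z : RR => P z.1 * Q z.2).
  apply: measurable_funM.
    by apply: measurableT_comp mP _; exact: measurable_fst.
  by apply: measurableT_comp mQ _; exact: measurable_snd.
have iPQ : (mu \x mu)%E.-integrable setT (fun z : RR => (P z.1 * Q z.2)%:E).
  apply/integrable12ltyP; first exact/measurable_EFinP.
  have -> : (\int[mu]_x \int[mu]_y `|(P x * Q y)%:E| =
             \int[mu]_x (`|(P x)%:E| * \int[mu]_y `|(Q y)%:E|))%E.
    apply: eq_integral => x _; rewrite -ge0_integralZl //; last first.
      by apply: measurableT_comp => //; exact/measurable_EFinP.
    by apply: eq_integral => y _; rewrite EFinM abseM.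
  rewrite ge0_integralZr //; last 2 first.
  - by apply: measurableT_comp => //; exact/measurable_EFinP.
  - by apply: integral_ge0.
  case/integrableP : iP => _ iP; case/integrableP : iQ => _ iQ.
  by apply: lte_mul_pinfty => //; [exact: integral_ge0|rewrite ge0_fin_numE// integral_ge0].
apply: (@eq_integrable _ _ _ _ _ measurableJJ (fun z : RR => (P z.1 * Q z.2)%:E)).
  by move=> z; rewrite inE => -[/= z1 z2]; rewrite /P /Q !patchE !mem_set.
by apply: integrableS iPQ => //; exact: measurableJJ.
Qed.

Lemma itg_restrict a b F : mu.-integrable `[a, b] (EFin \o F) ->
  (\int[mu]_x ((EFin \o F) \_ `[a, b]) x)%E = (itg a b F)%:E.
Proof.
move=> iF; rewrite -integral_mkcond /itg /Rintegral fineK //.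
exact: integrable_fin_num iF.
Qed.

Lemma fubini_square f : jint f ->
  integ (fun x => itg (-1) 1 (f x)) /\
  itg (-1) 1 (fun x => itg (-1) 1 (f x)) = itg (-1) 1 (fun y => itg (-1) 1 (f^~ y)).
Proof.
move=> [i1 i2 i3]; pose F := (fun z : RR => (f z.1 z.2)%:E) \_ JJ.
have iF : (mu \x mu)%E.-integrable setT F.
  by apply/(integrable_mkcond _ measurableJJ).1.
have FA : (fun x => \int[mu]_y F (x, y))%E = (EFin \o (fun x => itg (-1) 1 (f x))) \_ J.
  apply/funext => x; rewrite patchE; case: ifPn => [xJ|].
    have /inJE Jx : J x by rewrite inE in xJ.
    rewrite [RHS]/= -itg_restrict; last exact: i2.
    apply: eq_integral => y _; rewrite /F !patchE /=.
    by rewrite mem_JJ xJ.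
  rewrite notin_setE => xJ; rewrite integral0_eq // => y _.
  by rewrite /F patchE; case: ifPn => //; rewrite inE => -[].
have FB : (fun y => \int[mu]_x F (x, y))%E = (EFin \o (fun y => itg (-1) 1 (f^~ y))) \_ J.
  apply/funext => y; rewrite patchE; case: ifPn => [yJ|].
    have /inJE Jy : J y by rewrite inE in yJ.
    rewrite [RHS]/= -itg_restrict; last exact: i3.
    apply: eq_integral => x _; rewrite /F !patchE /=.
    by rewrite mem_JJ yJ andbT.
  rewrite notin_setE => yJ; rewrite integral0_eq // => x _.
  by rewrite /F patchE; case: ifPn => //; rewrite inE => -[].
split.
  have iA := integrable_fubini_F iF; rewrite /fubini_F FA in iA.
  by apply/(integrable_mkcond _ _).2 => //; exact: measurableJ.
rewrite /itg /Rintegral; congr (fine _).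
rewrite [LHS]integral_mkcond [RHS]integral_mkcond -FA -FB; exact: Fubini.
Qed.

Lemma itg_indic a b F : inJ a -> inJ b ->
  itg (-1) 1 (fun x => (a <= x <= b)%R%:R * F x) = itg a b F.
Proof.
move=> [a1 a2] [b1 b2]; rewrite /itg [LHS]Rintegral_mkcond [RHS]Rintegral_mkcond.
apply: eq_Rintegral => x _; rewrite !patchE.
have -> : (x \in `[a, b]%classic) = (a <= x <= b).
  by apply/idP/idP; rewrite inE /= in_itv.
case: ifPn => [_|/negP xJ]; first by case: ifPn; rewrite (mul1r, mul0r).
case: ifPn => // /andP[ax xb]; case: xJ; rewrite inE; apply/inJE; split.
  exact: le_trans ax.
exact: le_trans b2.
Qed.

Lemma jint_triangle f s : jint f -> jint (fun x y => (y <= x <= s)%R%:R * f x y).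
Proof.
apply: (@jint_mul _ _ 1); split.
  apply: (measurable_comp (F := [set: bool]) (f := (fun b : bool => b%:R : R))) => //.
  have m1 := @measurable_fst _ _ (measurableTypeR R) (measurableTypeR R).
  have m2 := @measurable_snd _ _ (measurableTypeR R) (measurableTypeR R).
  apply: measurable_funTS.
  by apply: measurable_and; apply: measurable_fun_ler.
by move=> x y _ _; case: (y <= x <= s); rewrite ?normr1 ?normr0.
Qed.

(** Fubini on the square for [f] times the indicator of the triangle $y\le x\le s$. *)
Lemma fubini_triangle f s : jint f -> inJ s ->
  itg (-1) s (fun x => itg (-1) x (f x)) = itg (-1) s (fun y => itg y s (f^~ y)).
Proof.
move=> jf Js; have [s1 s2] := Js; have JN1 := @inJN1 R.
rewrite -[LHS](itg_indic _ JN1 Js) -[RHS](itg_indic _ JN1 Js).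
have [_ fub] := fubini_square (jint_triangle s jf).
have N11 : (-1 : R) <= 1 by lra.
have itg0 F : (forall x, -1 <= x <= 1 -> F x = 0) -> itg (-1) 1 F = 0.
  by move=> /eq_itg ->; rewrite itg_cst // mul0r.
transitivity (itg (-1) 1 (fun x => itg (-1) 1 (fun y => (y <= x <= s)%R%:R * f x y))).
  apply: eq_itg => x /[dup] /andP[x1 x2] Jx; rewrite x1 /=.
  case: (leP x s) => xs; last first.
    by rewrite mul0r itg0 // => y _; rewrite andbF mul0r.
  rewrite mul1r -[LHS](itg_indic _ JN1 (conj x1 x2)); apply: eq_itg => y /andP[-> _].
  by rewrite andbT.
rewrite fub; apply: eq_itg => y /[dup] /andP[y1 y2] Jy; rewrite y1 /=.
case: (leP y s) => ys.
  by rewrite mul1r -[RHS](itg_indic _ (conj y1 y2) Js).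
rewrite mul0r itg0 // => x _; case: (leP y x) => yx; rewrite ?mul0r //=.
by rewrite leNgt (lt_le_trans ys yx) mul0r.
Qed.

Lemma integ_triangle f : jint f -> integ (fun x => itg (-1) x (f x)).
Proof.
move=> jf; have [+ _] := fubini_square (jint_triangle 1 jf).
apply: integ_ext => x Jx; have [x1 x2] := Jx.
rewrite -[RHS](itg_indic _ (@inJN1 R) Jx).
by apply: eq_itg => y /andP[y1 _]; rewrite y1 x2 andbT.
Qed.

(** The double integral of $p(x)g(y)$ over the triangle $-1\le y\le x\le s$ is computed in both
    orders: one gives $\int p\,(G-G(-1))$, the other $\int (F(s)-F)\,g$. Their equality is the
    integrated product rule. *)
Lemma AC_mul F p G g : AC F p -> AC G g ->
  AC (fun x => F x * G x) (fun x => p x * G x + F x * g x).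
Proof.
move=> ACF ACG; have [ip Fp] := ACF; have [ig Gg] := ACG; split.
  apply: integD; last exact: AC_integ_mul ACF ig.
  by apply: integ_ext (AC_integ_mul ACG ip) => x _; rewrite mulrC.
move=> s Js; have [s1 s2] := Js; have JN1 := @inJN1 R.
have tri := fubini_triangle (jint_prod ip ig) Js.
have E1 : itg (-1) s (fun x => itg (-1) x (fun y => p x * g y)) =
          itg (-1) s (fun x => p x * G x) - G (-1) * itg (-1) s p.
  have iGp : integ (fun x => p x * G x).
    by apply: integ_ext (AC_integ_mul ACG ip) => x _; rewrite mulrC.
  rewrite -itgZ // -itgB //; try exact: integZ.
  apply: eq_itg => x /andP[x1 xs]; have Jx : inJ x by split; lra.
  by rewrite itgZ // (Gg x) //; ring.
have E2 : itg (-1) s (fun y => itg y s (fun x => p x * g y)) =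
          F s * itg (-1) s g - itg (-1) s (fun x => F x * g x).
  rewrite -itgZ // -itgB //; try solve [exact: integZ|exact: AC_integ_mul ACF ig].
  apply: eq_itg => y /andP[y1 ys]; have Jy : inJ y by split; lra.
  have -> : itg y s (fun x => p x * g y) = itg y s (fun x => g y * p x).
    by apply: eq_itg => x _; rewrite mulrC.
  by rewrite itgZ // (AC_itg ACF Jy Js) //; ring.
rewrite itgD //; last exact: AC_integ_mul ACF ig.
  move: tri; rewrite E1 E2 => tri.
  have -> : itg (-1) s (fun x => p x * G x) = G (-1) * itg (-1) s p +
     (F s * itg (-1) s g - itg (-1) s (fun x => F x * g x)) by rewrite -tri; ring.
  by rewrite (Gg s) // (Fp s) //; ring.
by apply: integ_ext (AC_integ_mul ACG ip) => x _; rewrite mulrC.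
Qed.

End Fubini.

(** * Differentiating integrals that depend on a parameter *)

Section Volterra.
Variable R : realType.
Local Notation mu := (@lebesgue_measure R).
Local Notation J := (`[(-1 : R), 1]%classic).
Local Notation RR := (measurableTypeR R * measurableTypeR R)%type.
Local Notation JJ := (J `*` J : set RR).
Implicit Types (g F G : R -> R) (f h : R -> R -> R) (a b c s t x y : R).

(** Leibniz's rule, with the usual diagonal term $f(s,s)$ rewritten as $f(s,-1)+\int_{-1}^s
    f_t(s,t)\,dt$. In this form only $f_s+f_t$ occurs under the integral, a sum in which the
    derivatives of a factor depending on $s-t$ cancel. *)
Lemma AC_volterra f fs ft :
  (forall t, inJ t -> AC (f^~ t) (fs^~ t)) -> (forall s, inJ s -> AC (f s) (ft s)) ->
  jint fs -> jint ft ->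
  AC (fun s => itg (-1) s (f s))
     (fun s => f s (-1) + itg (-1) s (fun t => fs s t + ft s t)).
Proof.
move=> ACs ACt jfs jft; have JN1 := @inJN1 R.
have jst := jintD jfs jft.
have ib : integ (f^~ (-1)) := AC_integ (ACs _ JN1).
have it := integ_triangle jft; have ist := integ_triangle jst.
have is_ := integ_triangle jfs.
have id : integ (fun t => f t t).
  by apply: integ_ext (integD ib it) => x Jx; rewrite ((ACt x Jx).2 x Jx).
split; first exact: integD.
move=> s Js; have [s1 s2] := Js; rewrite itgxx add0r.
have E1 : itg (-1) s (fun x => itg (-1) x (fs x)) =
    itg (-1) s (f s) - itg (-1) s (fun t => f t t).
  have ifs := AC_integ (ACt s Js).
  rewrite fubini_triangle // -itgB //.
  apply: eq_itg => t /andP[t1 ts]; have Jt : inJ t by split; lra.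
  by rewrite (AC_itg (ACs t Jt) Jt Js ts) addrAC subrr add0r.
have E2 : itg (-1) s (fun t => f t t) =
          itg (-1) s (f^~ (-1)) + itg (-1) s (fun x => itg (-1) x (ft x)).
  rewrite -itgD //; apply: eq_itg => x /andP[x1 xs].
  have Jx : inJ x by split; lra.
  by rewrite ((ACt x Jx).2 x Jx).
have E3 : itg (-1) s (fun x => itg (-1) x (fun t => fs x t + ft x t)) =
  itg (-1) s (fun x => itg (-1) x (fs x)) + itg (-1) s (fun x => itg (-1) x (ft x)).
  rewrite -itgD //; apply: eq_itg => x /andP[x1 xs]; have Jx : inJ x by split; lra.
  by rewrite itgD //; [case: jfs => _ + _; exact|case: jft => _ + _; exact].
by rewrite itgD // E3 E1; move: E2; lra.
Qed.

(** Differentiation under the integral sign: the increment $f(s,t)-f(-1,t)$ is an integral of [fs],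
    and Fubini exchanges the two integrations. *)
Lemma AC_square f fs :
  (forall t, inJ t -> AC (f^~ t) (fs^~ t)) -> (forall s, inJ s -> integ (f s)) ->
  jint fs -> AC (fun s => itg (-1) 1 (f s)) (fun s => itg (-1) 1 (fs s)).
Proof.
move=> ACs ift jfs; have [ifs fub] := fubini_square jfs; split => // s Js.
have JN1 := @inJN1 R; have J1 := @inJ1 R; have [s1 s2] := Js.
have jm : jmeas (fun x y : R => (x <= s)%R%:R : R) 1.
  split; last by move=> x y _ _; case: (x <= s); rewrite ?normr1 ?normr0.
  apply: (measurable_comp (F := [set: bool]) (f := (fun b : bool => b%:R : R))) => //.
  have m1 := @measurable_fst _ _ (measurableTypeR R) (measurableTypeR R).
  by apply: measurable_funTS; apply: measurable_fun_ler.
have [_ fub2] := fubini_square (jint_mul jm jfs).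
transitivity (itg (-1) 1 (f (-1)) + itg (-1) 1 (fun t => f s t - f (-1) t)).
  by rewrite (itgB JN1 J1 (ift _ Js) (ift _ JN1)) addrC subrK.
congr (_ + _); rewrite -[RHS](itg_indic _ JN1 Js).
transitivity (itg (-1) 1 (fun y => itg (-1) 1 (fun x => (x <= s)%R%:R * fs x y))).
  apply: eq_itg => t /andP Jt; rewrite (ACs t Jt).2 // addrAC subrr add0r.
  rewrite -(itg_indic _ JN1 Js); apply: eq_itg => x /andP[-> _].
  by [].
rewrite -fub2; apply: eq_itg => x /[dup] /andP[x1 x2] /andP Jx; rewrite x1 /=.
by rewrite itgZ //; case: jfs => _ + _; exact.
Qed.

Lemma AC_C1_interior F g : continuous F -> continuous g ->
  (forall x, -1 < x -> x < 1 -> is_derive x 1 F (g x)) -> AC F g.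
Proof.
move=> cF cg dF; have JN1 := @inJN1 R.
have ig : integ g.
  apply: continuous_compact_integrable; first exact: segment_compact.
  exact: continuous_subspaceT.
split => // s [s1 s2].
case: (ltP (-1) s) => [s1'|ss]; last first.
  by rewrite (_ : s = -1) ?itgxx ?addr0 //; apply/le_anti/andP.
have dF' x : x \in `]-1, s[ -> is_derive x 1 F (g x).
  by rewrite in_itv /= => /andP[x1 xs]; apply: dF => //; exact: lt_le_trans xs s2.
have := @continuous_FTC2 R g F (-1) s s1'.
rewrite /itg /Rintegral => ->.
- by rewrite -EFinB /=; ring.
- exact: continuous_subspaceT.
- split.
  + by move=> x xs; have [] := dF' x xs.
  + by apply: cvg_at_right_filter; exact: cF.
  + by apply: cvg_at_left_filter; exact: cF.
- by move=> x xs; rewrite derive1E; have [_ ->] := dF' x xs.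
Qed.

Lemma AC_C1 F g : (forall x, is_derive x 1 F (g x)) -> continuous g -> AC F g.
Proof.
move=> dF cg; apply: AC_C1_interior => // x.
by apply: differentiable_continuous; apply/derivable1_diffP; have [] := dF x.
Qed.

Lemma jmeas_conv (p : R -> R) (C : R) : continuous p -> (forall x, `|p x| <= C) ->
  jmeas (fun x y => p (x - y)) C.
Proof.
move=> cp pC; split => //; apply: measurable_funTS.
apply: (measurableT_comp (f := p)); first exact: continuous_measurable_fun.
by apply: measurable_funB; [exact: measurable_fst|exact: measurable_snd].
Qed.

(** Membership in $W^{m,\infty}$ with bound [C] on each derivative. The top derivative is only
    measurable and bounded. Sup-norm bounds are stronger than what $H^m$ asks, and they are stable
    under all the operations used below. *)
Definition tower (m : nat) (C : R) F : Prop :=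
  exists v : nat -> R -> R,
    [/\ forall s, inJ s -> v 0%N s = F s,
        forall j, (j < m)%N -> AC (v j) (v j.+1) &
        forall j, (j <= m)%N -> measurable_fun J (v j) /\ forall s, inJ s -> `|v j s| <= C].

(** The form of the derivative of a member of a doubly indexed family, one index being raised in
    each summand, as in the rule for $(\partial_s+\partial_t)$ or for a product. *)
Definition Delta (w : nat -> nat -> R -> R) (p q : nat) (s : R) : R :=
  w p.+1 q s + w p q.+1 s.

(** The $j$-th derivative is the $j$-th iterate of [Delta], a sum of $2^j$ members of total order
    $j$, each bounded by [C]. *)
Lemma tower_family m (C : R) (w : nat -> nat -> R -> R) :
  (forall p q, (p + q < m)%N -> AC (w p q) (Delta w p q)) ->
  (forall p q, (p + q <= m)%N ->
     measurable_fun J (w p q) /\ forall s, inJ s -> `|w p q s| <= C) ->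
  tower m (2 ^+ m * C) (w 0%N 0%N).
Proof.
move=> ACw bw.
have C0 : 0 <= C.
  by have [_ /(_ _ (@inJ1 R))] := bw 0%N 0%N isT; exact: le_trans.
have AC_iter j p q : (j + (p + q) < m)%N ->
    AC (iter j Delta w p q) (iter j.+1 Delta w p q).
  elim: j p q => [|j IHj] p q jm; first exact: ACw.
  by apply: ACD; apply: IHj; lia.
have b_iter j p q : (j + (p + q) <= m)%N ->
    measurable_fun J (iter j Delta w p q) /\
    forall s, inJ s -> `|iter j Delta w p q s| <= 2 ^+ j * C.
  elim: j p q => [|j IHj] p q jm; first by rewrite expr0 mul1r; exact: bw.
  have [|m1 b1] := IHj p.+1 q; first by lia.
  have [|m2 b2] := IHj p q.+1; first by lia.
  split; first exact: measurable_funD.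
  move=> s Js; apply: (le_trans (ler_normD _ _)).
  by rewrite exprS -mulrA mulr_natl mulr2n lerD ?b1 ?b2.
exists (fun j => iter j Delta w 0%N 0%N); split => // j jm.
  by apply: AC_iter; lia.
have [|mj bj] := b_iter j 0%N 0%N; first by lia.
split => // s Js; apply: (le_trans (bj s Js)); apply: ler_wpM2r => //.
by apply: ler_weXn2l => //; rewrite ler1n.
Qed.

End Volterra.

(** * Volterra integrals with an oscillating factor *)

Section Oscillatory.
Variable R : realType.
Local Notation mu := (@lebesgue_measure R).
Local Notation J := (`[(-1 : R), 1]%classic).
Local Notation RR := (measurableTypeR R * measurableTypeR R)%type.
Local Notation JJ := (J `*` J : set RR).
Implicit Types (g F G : R -> R) (a b c s t x y : R) (f : nat -> nat -> R -> R -> R).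

(* [f p q] stands for the mixed derivative of order [p] in [s] and [q] in [t]
   of [f 0 0] *)
Definition dfamily (m : nat) (C : R) f : Prop :=
  [/\ forall p q t, (p < m)%N -> (q <= m)%N -> inJ t ->
        AC (fun s => f p q s t) (fun s => f p.+1 q s t),
      forall p q s, (p <= m)%N -> (q < m)%N -> inJ s -> AC (f p q s) (f p q.+1 s),
      forall p q, (p <= m)%N -> (q <= m)%N -> jint (f p q),
      exists gamma, [/\ integ gamma, itg (-1) 1 gamma <= C &
        forall p q s t, (p <= m)%N -> (q <= m)%N -> inJ s -> inJ t ->
          `|f p q s t| <= gamma t] &
      forall p q s, (p <= m)%N -> (q < m)%N -> inJ s -> `|f p q s (-1)| <= C].

Section Corrected.
Variables (m : nat) (C M : R) (f : nat -> nat -> R -> R -> R).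
Variables (theta dtheta : R -> R) (zeta : nat -> R -> R).
Hypothesis m_gt0 : (0 < m)%N.
Hypothesis famf : dfamily m C f.
Hypothesis dth : forall x, is_derive x 1 theta (dtheta x).
Hypothesis cdth : continuous dtheta.
Hypothesis bth : forall x, `|theta x| <= 1.
Hypothesis bdth : exists K : R, forall x, `|dtheta x| <= K.
Hypothesis ACz0 : AC (zeta 0%N) (fun s => - theta (s + 1)).
Hypothesis ACz : forall j, AC (zeta j.+1) (zeta j).
Hypothesis bz : forall j s, (j < m)%N -> inJ s -> `|zeta j s| <= M.

Definition volterra theta f p q s := itg (-1) s (fun t => theta (s - t) * f p q s t).

(* The second sum cancels the boundary contribution at [t = -1] of the derivative
   of the integral, which carries the large factors. *)
Definition corrected (p q : nat) (s : R) : R :=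
  volterra theta f p q s + \sum_(j < m - q) zeta j s * f p (q + j)%N s (-1).

Let cth : continuous theta.
Proof.
move=> x; apply: differentiable_continuous; apply/derivable1_diffP.
by apply: ex_derive; exact: dth.
Qed.

Let ACth_s t : AC (fun s => theta (s - t)) (fun s => dtheta (s - t)).
Proof.
apply: AC_C1 => [x|x].
  have := dth (x - t); rewrite -[X in is_derive X]/(shift (- t) x) => d.
  have ds : is_derive x 1 (shift (- t)) (1 : R) by apply: is_derive_shift.
  by have := is_derive1_comp d ds; rewrite mulr1.
by apply: continuous_comp; [apply: cvgB => //; exact: cvg_cst|exact: cdth].
Qed.

Let ACth_t s : AC (fun t => theta (s - t)) (fun t => - dtheta (s - t)).
Proof.
apply: AC_C1 => [x|x].
  pose g y := s - y.
  have dg : is_derive x 1 g (-1 : R).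
    by rewrite -[-1]sub0r; exact: (@is_deriveB _ _ _ (cst s) id).
  have dt : is_derive (g x) 1 theta (dtheta (s - x)) := dth _.
  by have := is_derive1_comp dt dg; rewrite mulrN1.
apply: cvgN; apply: continuous_comp; last exact: cdth.
by apply: cvgB => //; exact: cvg_cst.
Qed.

(** The $s$- and $t$-derivatives of $\theta(s-t)$ are opposite, so [dtheta] drops out of the sum
    supplied by [AC_volterra]. *)
Lemma AC_volterra_theta p q : (p < m)%N -> (q < m)%N ->
  AC (volterra theta f p q)
     (fun s => theta (s + 1) * f p q s (-1) +
               (volterra theta f p.+1 q s + volterra theta f p q.+1 s)).
Proof.
move=> pm qm; have [a1 a2 a3 [ga [ga1 ga2 ga3]] a5] := famf.
have [K bK] := bdth.
have jth := jmeas_conv cth bth; have jdth := jmeas_conv cdth bK.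
have jp := jint_mul jth (a3 _ _ pm (ltnW qm)).
have jq := jint_mul jth (a3 _ _ (ltnW pm) qm).
have jd := jint_mul jdth (a3 _ _ (ltnW pm) (ltnW qm)).
have jmN1 : jmeas (fun _ _ : R => -1 : R) 1.
  by split => // x y _ _; rewrite normrN1.
have jNd := jint_mul jmN1 jd.
have jNd' : jint (fun s t => - dtheta (s - t) * f p q s t).
  by apply: jint_ext jNd => x y _ _; ring.
have /AC_ext := @AC_volterra R (fun s t => theta (s - t) * f p q s t)
  (fun s t => dtheta (s - t) * f p q s t + theta (s - t) * f p.+1 q s t)
  (fun s t => - dtheta (s - t) * f p q s t + theta (s - t) * f p q.+1 s t)
  (fun t Jt => AC_mul (ACth_s t) (a1 p q t pm (ltnW qm) Jt))
  (fun s Js => AC_mul (ACth_t s) (a2 p q s (ltnW pm) qm Js))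
  (jintD jd jp) (jintD jNd' jq).
apply => // s Js; rewrite opprK; congr (_ + _).
rewrite /volterra -itgD //; try exact: inJN1.
- by apply: eq_itg => t _; ring.
- by case: jp => _ + _; exact.
- by case: jq => _ + _; exact.
Qed.

(** In the derivative of the correction, the term $j=0$ carrying $\zeta_0'=-\theta(s+1)$ cancels the
    boundary term of the integral. The other terms with a differentiated $\zeta_j$ become, after a
    shift of $j$, the correction of index $(p,q+1)$, whose length $m-(q+1)$ is one less. The terms
    where [f] is differentiated form the correction of index $(p+1,q)$. *)
Lemma AC_corrected p q : (p + q < m)%N ->
  AC (corrected p q) (Delta corrected p q).
Proof.
move=> pqm; have pm : (p < m)%N by lia. have qm : (q < m)%N by lia.
have [a1 a2 a3 _ _] := famf.
pose dzeta j s := if j is j'.+1 then zeta j' s else - theta (s + 1).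
have ACdz j : AC (zeta j) (dzeta j) by case: j.
have AC2 : AC (fun s => \sum_(j < m - q) zeta j s * f p (q + j)%N s (-1))
   (fun s => \sum_(j < m - q) (dzeta j s * f p (q + j)%N s (-1) +
                               zeta j s * f p.+1 (q + j)%N s (-1))).
  apply: (@AC_sum _ _ (fun j s => zeta j s * f p (q + j)%N s (-1))
    (fun j s => dzeta j s * f p (q + j)%N s (-1) + zeta j s * f p.+1 (q + j)%N s (-1))).
  move=> j jq; apply: AC_mul => //; by apply: a1 => //; lia.
apply: AC_ext (ACD (AC_volterra_theta pm qm) AC2) => // s Js.
rewrite /Delta /corrected big_split /=.
have -> : (m - q = (m - q.+1).+1)%N by lia.
rewrite big_ord_recl /= addn0.
have -> : \sum_(i < m - q.+1) dzeta (bump 0 i) s * f p (q + bump 0 i)%N s (-1) =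
  \sum_(j < m - q.+1) zeta j s * f p (q.+1 + j)%N s (-1).
  by apply: eq_bigr => i _; rewrite /bump leq0n add1n addSnnS.
ring.
Qed.

(** The bound uses $|\theta|\le1$, $|\zeta_j|\le M$ and the constant of the family, but not the
    bound on [dtheta]; this is where uniformity in the frequency comes from. *)
Lemma tower_corrected : tower m (2 ^+ m * (C + m%:R * (M * C))) (corrected 0%N 0%N).
Proof.
apply: tower_family; first exact: AC_corrected.
move=> p q pqm; have [a1 a2 a3 [ga [ga1 ga2 ga3]] a5] := famf.
have pm : (p <= m)%N by lia. have qm : (q <= m)%N by lia.
have JN1 := @inJN1 R.
have jth := jint_mul (jmeas_conv cth bth) (a3 _ _ pm qm); split.
  apply: measurable_funD; first exact: integ_measurable (integ_triangle jth).
  apply: measurable_sum => j; apply: measurable_funM.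
    by case: {+}(nat_of_ord j) => [|j']; [exact: AC_measurable ACz0|exact: AC_measurable (ACz j')].
  have [|_ _ /(_ _ JN1)] := a3 p (q + j)%N pm; first by have := ltn_ord j; lia.
  exact: integ_measurable.
move=> s Js; apply: (le_trans (ler_normD _ _)); apply: lerD.
  apply: le_trans ga2; apply: norm_itg_le => //; first by case: Js.
    by case: jth => _ + _; exact.
  move=> t Jt; rewrite normrM; apply: le_trans (ga3 _ _ _ _ pm qm Js Jt).
  by rewrite ler_piMl.
apply: (le_trans (ler_norm_sum _ _ _)).
have C0 : 0 <= C by apply: le_trans (a5 _ _ _ (leqnn m) m_gt0 JN1).
have M0 : 0 <= M by apply: le_trans (bz m_gt0 JN1).
apply: (@le_trans _ _ (\sum_(j < m - q) (M * C))).
  apply: ler_sum => j _; rewrite normrM; have jq := ltn_ord j.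
  by apply: ler_pM => //; [apply: bz => //; lia|apply: a5 => //; lia].
rewrite sumr_const card_ord -[leLHS]mulr_natl; apply: ler_wpM2r; first exact: mulr_ge0.
by rewrite ler_nat; lia.
Qed.

End Corrected.
End Oscillatory.

(** * Cosine phases and the zero frequency *)

Section Exponential.
Variable R : realType.
Local Notation J := (`[(-1 : R), 1]%classic).
Implicit Types (a b c s t x y om phi : R) (f : nat -> nat -> R -> R -> R).

Lemma is_derive_affine om phi x : is_derive x 1 (fun y => om * y + phi) om.
Proof.
rewrite -[X in is_derive _ _ _ X]addr0.
apply: (@is_deriveD _ _ _ (fun y => om * y) (cst phi)).
by rewrite -[X in is_derive _ _ _ X]mulr1; exact: (@is_deriveZ _ _ _ id).
Qed.

Lemma continuous_affine om phi : continuous (fun y : R => om * y + phi).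
Proof. by move=> x; apply: cvgD; [apply: cvgMr; exact: cvg_id|exact: cvg_cst]. Qed.

Lemma is_derive_cos_affine om phi x :
  is_derive x 1 (fun y => cos (om * y + phi)) (- (om * sin (om * x + phi))).
Proof.
pose g y := om * y + phi.
have dg : is_derive x 1 g om by exact: is_derive_affine.
have := is_derive1_comp (is_derive_cos (g x)) dg.
by rewrite mulNr mulrC.
Qed.

Lemma continuous_sin_affine om phi : continuous (fun y : R => - (om * sin (om * y + phi))).
Proof.
move=> x; apply: cvgN; apply: cvgMr.
apply: continuous_comp; [exact: continuous_affine|exact: continuous_sin].
Qed.

Lemma AC_cos_affine om phi :
  AC (fun y => cos (om * y + phi)) (fun x => - (om * sin (om * x + phi))).
Proof. by apply: AC_C1 => [x|]; [exact: is_derive_cos_affine|exact: continuous_sin_affine]. Qed.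

Definition monom (n : nat) s : R := n`!%:R^-1 * (s + 1) ^+ n.

Lemma AC_monom n : AC (monom n.+1) (monom n).
Proof.
apply: AC_C1 => [x|x]; last first.
  apply: cvgMr; apply: (@continuous_comp _ _ _ (fun y : R => y + 1) (fun y : R => y ^+ n)).
    by apply: cvgD; [exact: cvg_id|exact: cvg_cst].
  exact: exprn_continuous.
rewrite /monom.
have d : is_derive x 1 (fun y : R => y + 1) 1.
  exact: (@is_derive_shift _ x 1 1).
have := is_deriveX n.+1 d; rewrite exprfctE => /(is_deriveZ ((n.+1)`!%:R^-1)).
have -> : (n.+1)`!%:R^-1 *: ((n.+1%:R * (x + 1) ^+ n.+1.-1) *: (1 : R)) =
    n`!%:R^-1 * (x + 1) ^+ n.
  rewrite /GRing.scale /= mulr1 factS natrM; field.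
  by rewrite nat1r !pnatr_eq0 -lt0n fact_gt0.
exact.
Qed.

Lemma AC_monom0 : AC (monom 0) (fun=> 0).
Proof.
by apply: AC_ext (AC_cst (1 : R)) => // x _; rewrite /monom fact0 invr1 mul1r expr0.
Qed.

Lemma monom_le n (N : nat) s : (n <= N)%N -> inJ s -> `|monom n s| <= 2 ^+ N.
Proof.
move=> nN [s1 s2]; rewrite /monom normrM normfV normr_nat.
apply: (@le_trans _ _ (1 * `|(s + 1) ^+ n|)).
  by apply: ler_wpM2r => //; rewrite invf_le1 ?ltr0n ?fact_gt0 // ler1n fact_gt0.
rewrite mul1r normrX; apply: (@le_trans _ _ (2 ^+ n)).
  by apply: lerXn2r; rewrite ?nnegrE // ler_norml; apply/andP; split; lra.
by apply: ler_weXn2l => //; rewrite ler1n.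
Qed.

Lemma towerD m (C1 C2 : R) F G : tower m C1 F -> tower m C2 G ->
  tower m (C1 + C2) (fun s => F s + G s).
Proof.
move=> [v [v1 v2 v3]] [w [w1 w2 w3]]; exists (fun j s => v j s + w j s); split.
- by move=> s Js; rewrite v1 ?w1.
- by move=> j jm; apply: ACD; [exact: v2|exact: w2].
move=> j jm; have [mv bv] := v3 j jm; have [mw bw] := w3 j jm; split.
  exact: measurable_funD.
by move=> s Js; apply: (le_trans (ler_normD _ _)); rewrite lerD ?bv ?bw.
Qed.

Lemma towerZ m c (C : R) F : tower m C F -> tower m (`|c| * C) (fun s => c * F s).
Proof.
move=> [v [v1 v2 v3]]; exists (fun j s => c * v j s); split.
- by move=> s Js; rewrite v1.
- by move=> j jm; apply: ACZ; exact: v2.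
move=> j jm; have [mv bv] := v3 j jm; split; first exact: measurable_funM.
by move=> s Js; rewrite normrM ler_wpM2l ?bv.
Qed.

Lemma tower_le m (C1 C2 : R) F : C1 <= C2 -> tower m C1 F -> tower m C2 F.
Proof.
move=> C12 [v [v1 v2 v3]]; exists v; split => // j jm; have [mv bv] := v3 j jm.
by split => // s Js; apply: le_trans C12; exact: bv.
Qed.

Lemma tower_ext m (C : R) F G : (forall s, inJ s -> F s = G s) ->
  tower m C F -> tower m C G.
Proof. by move=> FG [v [v1 v2 v3]]; exists v; split => // s Js; rewrite v1 ?FG. Qed.

Lemma tower0 m (C : R) : 0 <= C -> tower m C (fun=> 0).
Proof.
move=> C0; exists (fun _ _ => 0); split => // [j _|j _]; first exact: AC_cst.
by split => // s _; rewrite normr0.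
Qed.

Lemma towerN m (C : R) F : tower m C F -> tower m C (fun s => - F s).
Proof.
move=> /(towerZ (-1)); rewrite normrN1 mul1r; apply: tower_ext => s _.
by rewrite mulN1r.
Qed.

Lemma tower_sum m n (C : R) (F : nat -> R -> R) : (forall j, (j < n)%N -> tower m C (F j)) ->
  tower m (n%:R * C) (fun s => \sum_(j < n) F j s).
Proof.
elim: n => [|n IHn] tF.
  by apply: tower_ext (tower0 m _) => [s _|]; rewrite ?big_ord0 ?mul0r.
have := towerD (IHn (fun j jn => tF j (ltnW jn))) (tF n (ltnSn n)).
have -> : n%:R * C + C = n.+1%:R * C by rewrite -natr1 mulrDl mul1r.
by apply: tower_ext => s _; rewrite big_ord_recr.
Qed.

Section Family.
Variables (m : nat) (C : R) (f : nat -> nat -> R -> R -> R).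
Hypothesis m_gt0 : (0 < m)%N.
Hypothesis famf : dfamily m C f.

Lemma dfamily_bound_ge0 : 0 <= C.
Proof.
have [_ _ _ _ a5] := famf.
exact: le_trans (a5 m 0%N (-1) (leqnn m) m_gt0 (@inJN1 R)).
Qed.

Lemma tower_boundary j : (j < m)%N -> tower m C (fun s => f 0%N j s (-1)).
Proof.
move=> jm; have [a1 a2 a3 a4 a5] := famf; exists (fun p s => f p j s (-1)).
split => // p pm; first by apply: a1 => //; exact: ltnW.
split; last by move=> s Js; exact: a5.
by have [_ _ /(_ _ (@inJN1 R)) /integ_measurable] := a3 p j pm (ltnW jm).
Qed.

(* Phase [phi = 0] gives the cosine and [phi = - pi / 2] the sine. *)
Lemma volterra_cos om phi : 1 <= `|om| ->
  exists2 w, tower m (2 ^+ m * (C + m%:R * (1 * C))) w &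
    forall s, volterra (fun x => cos (om * x + phi)) f 0 0 s = w s +
      \sum_(j < m) om^-1 ^+ j.+1 * cos (om * s + phi + (om - j.+1%:R * (pi / 2))) *
        f 0%N j s (-1).
Proof.
move=> om1.
have om0 : om != 0 by apply: contraTneq om1 => ->; rewrite normr0 -ltNge ltr01.
pose th x := cos (om * x + phi).
(* Each integration of a cosine divides by [om] and moves the phase by $-\pi/2$. The additional [om]
   in the phase comes from evaluating $\theta$ at $s+1$. *)
pose zeta n s := - (om^-1 ^+ n.+1 * cos (om * s + phi + (om - n.+1%:R * (pi / 2)))).
have ACz' n : AC (zeta n) (fun s => - (om^-1 ^+ n * cos (om * s + phi + (om - n%:R * (pi / 2))))).
  have := ACZ (- om^-1 ^+ n.+1) (AC_cos_affine om (phi + (om - n.+1%:R * (pi / 2)))).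
  apply: AC_ext => s _; first by rewrite /zeta mulNr addrA.
  have -> : sin (om * s + (phi + (om - n.+1%:R * (pi / 2)))) =
      - cos (om * s + phi + (om - n%:R * (pi / 2))).
    rewrite -sinBpihalf; congr sin; rewrite -natr1; ring.
  by rewrite exprSr; field.
exists (corrected m f th zeta 0%N 0%N).
  apply: (@tower_corrected _ m C 1 f th (fun x => - (om * sin (om * x + phi))) zeta) => //.
  - by move=> x; exact: is_derive_cos_affine.
  - exact: continuous_sin_affine.
  - by move=> x; rewrite /th; exact: cos_max.
  - exists `|om| => x; rewrite normrN normrM ler_piMr //; exact: sin_max.
  - apply: AC_ext (ACz' 0%N) => // s _; rewrite expr0 mul1r mul0r subr0 /th; congr (- cos _).
    ring.
  - move=> j s _ _; rewrite /zeta normrN normrM normrX normfV.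
    apply: mulr_ile1 => //; last exact: cos_max.
    by apply: exprn_ile1; rewrite ?invr_ge0 // invf_le1 // (lt_le_trans ltr01).
move=> s; rewrite /corrected subn0 -addrA -big_split /= big1 ?addr0 // => j _.
by rewrite add0n /zeta; ring.
Qed.

(** With $\theta=1$ the iterated primitives are $-(s+1)^{n+1}/(n+1)!$, so the correction itself has
    $m$ bounded derivatives and can be subtracted again, leaving no oscillating part. The second
    summand of the constant bounds the $m$ correction terms. *)
Lemma volterra_const :
  tower m (2 ^+ m * (C + m%:R * (2 ^+ m * C)) + m%:R * (2 ^+ m * (2 ^+ m * C)))
    (volterra (fun=> 1) f 0 0).
Proof.
pose zeta n s := - monom n.+1 s.
have C0 := dfamily_bound_ge0.
have T1 : tower m (2 ^+ m * (C + m%:R * (2 ^+ m * C)))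
    (corrected m f (fun=> 1) zeta 0%N 0%N).
  apply: (@tower_corrected _ m C (2 ^+ m) f (fun=> 1) (fun=> 0) zeta) => //.
  - by move=> x; exact: cvg_cst.
  - by move=> x; rewrite normr1.
  - by exists 0 => x; rewrite normr0.
  - apply: AC_ext (ACN (AC_monom 0)) => // s _.
    by rewrite /monom fact0 invr1 mul1r expr0.
  - by move=> j; apply: ACN; exact: AC_monom.
  - by move=> j s jm Js; rewrite normrN monom_le.
have T2 j : (j < m)%N -> tower m (2 ^+ m * (2 ^+ m * C)) (fun s => monom j.+1 s * f 0%N j s (-1)).
  (* [z n] is the $n$-th derivative of [monom j.+1], set to zero once the degree is exhausted;
     [tower_family] then plays the role of the Leibniz formula. *)
  move=> jm; pose z n s := if (n <= j.+1)%N then monom (j.+1 - n) s else 0.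
  have [a1 a2 a3 a4 a5] := famf.
  have ACz n : AC (z n) (z n.+1).
    rewrite /z; case: (ltngtP n j.+1) => [nj|nj|->].
    - by rewrite (_ : (j.+1 - n = (j.+1 - n.+1).+1)%N); [exact: AC_monom|lia].
    - exact: AC_cst.
    - by rewrite subnn; exact: AC_monom0.
  have -> : (fun s => monom j.+1 s * f 0%N j s (-1)) = (fun s => z 0%N s * f 0%N j s (-1)).
    by apply/funext => s; rewrite /z subn0.
  apply: (@tower_family R m (2 ^+ m * C) (fun p n s => z n s * f p j s (-1))).
    move=> p n pn; have := AC_mul (ACz n) (a1 p j (-1) _ _ (@inJN1 R)).
    move=> /(_ ltac:(lia) ltac:(lia)).
    by apply: AC_ext => // s _; rewrite /Delta addrC.
  move=> p n pn; have pm : (p <= m)%N by lia.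
  split; last first.
    move=> s Js; rewrite normrM; apply: ler_pM => //; last exact: a5.
    by rewrite /z; case: ifP => _; rewrite ?normr0 ?exprn_ge0 //; apply: monom_le => //; lia.
  apply: measurable_funM; first exact: AC_measurable (ACz n).
  by have [_ _ /(_ _ (@inJN1 R)) /integ_measurable] := a3 p j pm (ltnW jm).
apply: tower_ext (towerD T1 (tower_sum T2)) => s _.
rewrite /corrected subn0 -addrA -big_split /= big1 ?addr0 // => j _.
by rewrite add0n /zeta; ring.
Qed.

End Family.
End Exponential.

(** * Mixed derivatives of a kernel times a function *)

Section KernelTimesFunction.
Variable R : realType.
Local Notation J := (`[(-1 : R), 1]%classic).
Implicit Types (s t : R) (D : nat -> nat -> R -> R -> R) (G : nat -> R -> R).

Definition kernel (m : nat) (C : R) D : Prop :=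
  [/\ forall a b t, (a < m)%N -> (b <= m)%N -> inJ t ->
        AC (fun s => D a b s t) (fun s => D a.+1 b s t),
      forall a b s, (a <= m)%N -> (b < m)%N -> inJ s -> AC (D a b s) (D a b.+1 s) &
      forall a b, (a <= m)%N -> (b <= m)%N -> jmeas (D a b) C].

(** The regularity that an $H^m$ function offers: derivatives below order [m] are absolutely
    continuous and bounded, while the last one is only controlled in $L^1$. *)
Definition source (m : nat) (C : R) G : Prop :=
  [/\ forall j, (j < m)%N -> AC (G j) (G j.+1),
      forall j s, (j < m)%N -> inJ s -> `|G j s| <= C,
      integ (G m) & itg (-1) 1 (fun t => `|G m t|) <= C].

Definition Delta2 (w : nat -> nat -> R -> R -> R) (b i : nat) s t : R :=
  w b.+1 i s t + w b i.+1 s t.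

Variables (m : nat) (CD CG : R) (D : nat -> nat -> R -> R -> R) (G : nat -> R -> R).
Hypothesis m_gt0 : (0 < m)%N.
Hypothesis kD : kernel m CD D.
Hypothesis sG : source m CG G.

Let w j p := iter j Delta2 (fun b i s t => D p b s t * G i t).

(** The mixed derivative $\partial_s^p\partial_t^q$ of $D(s,t)G(t)$, kept as an iterated two-term
    sum so that no binomial coefficients arise. *)
Definition leibniz (p q : nat) (s t : R) : R :=
  iter q Delta2 (fun b i s t => D p b s t * G i t) 0%N 0%N s t.

(** One integrable function dominating all derivatives of [G] up to order [m]. *)
Let gamma t := CG + `|G m t|.

Lemma source_integ i : (i <= m)%N -> integ (G i).
Proof.
have [g1 g2 g3 g4] := sG; rewrite leq_eqVlt => /predU1P[->//|im].
exact: AC_integ (g1 i im).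
Qed.

Let CG0 : 0 <= CG.
Proof. by have [_ g2 _ _] := sG; exact: le_trans (g2 0%N (-1) m_gt0 (@inJN1 R)). Qed.

Let CD0 : 0 <= CD.
Proof.
have [_ _ /(_ 0%N 0%N isT isT) [_ H]] := kD.
exact: le_trans (H (-1) (-1) (@inJN1 R) (@inJN1 R)).
Qed.

Let G_gamma i t : (i <= m)%N -> inJ t -> `|G i t| <= gamma t.
Proof.
have [g1 g2 g3 g4] := sG; rewrite leq_eqVlt => /predU1P[->|im] Jt.
  by rewrite /gamma lerDr.
by apply: (le_trans (g2 _ _ im Jt)); rewrite /gamma lerDl.
Qed.

Let w_AC_s j p b i t : (j + (b + i) <= m)%N -> (p < m)%N -> inJ t ->
  AC (fun s => w j p b i s t) (fun s => w j p.+1 b i s t).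
Proof.
have [k1 k2 k3] := kD.
elim: j b i => [|j IHj] b i jm pm Jt; last by apply: ACD; apply: IHj => //; lia.
have bm : (b <= m)%N by lia.
by have := ACZ (G i t) (k1 p b t pm bm Jt); apply: AC_ext => s _; rewrite mulrC.
Qed.

Let w_AC_t j p b i s : (j + (b + i) < m)%N -> (p <= m)%N -> inJ s ->
  AC (w j p b i s) (w j.+1 p b i s).
Proof.
have [k1 k2 k3] := kD; have [g1 _ _ _] := sG.
elim: j b i => [|j IHj] b i jm pm Js; last by apply: ACD; apply: IHj => //; lia.
by apply: AC_mul; [apply: k2 => //; lia|apply: g1; lia].
Qed.

Let w_jint j p b i : (j + (b + i) <= m)%N -> (p <= m)%N -> jint (w j p b i).
Proof.
have [k1 k2 k3] := kD.
elim: j b i => [|j IHj] b i jm pm; last by apply: jintD; apply: IHj => //; lia.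
have bm : (b <= m)%N by lia.
have im : (i <= m)%N by lia.
apply: jint_ext (jint_mul (k3 p b pm bm)
  (jint_prod (integ_cst (1 : R)) (source_integ im))) => x y _ _.
by rewrite mul1r.
Qed.

Let w_bnd j p b i s t : (j + (b + i) <= m)%N -> (p <= m)%N -> inJ s -> inJ t ->
  `|w j p b i s t| <= 2 ^+ j * (CD * gamma t).
Proof.
have [k1 k2 k3] := kD.
elim: j b i => [|j IHj] b i jm pm Js Jt.
  rewrite expr0 mul1r normrM; apply: ler_pM => //.
    by have [|_ ->] := k3 p b pm; first lia.
  by apply: G_gamma => //; lia.
rewrite exprS -mulrA mulr_natl mulr2n.
by rewrite (le_trans (ler_normD _ _)) // lerD // IHj //; lia.
Qed.

Let w_bnd1 j p b i s : (j + (b + i) < m)%N -> (p <= m)%N -> inJ s ->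
  `|w j p b i s (-1)| <= 2 ^+ j * (CD * CG).
Proof.
have [k1 k2 k3] := kD; have [_ g2 _ _] := sG; have JN1 := @inJN1 R.
elim: j b i => [|j IHj] b i jm pm Js.
  rewrite expr0 mul1r normrM; apply: ler_pM => //.
    by have [|_ ->] := k3 p b pm; first lia.
  by apply: g2 => //; lia.
rewrite exprS -mulrA mulr_natl mulr2n.
by rewrite (le_trans (ler_normD _ _)) // lerD // IHj //; lia.
Qed.

(** The factor $2^m$ counts the terms of the iterated sum. The factor 3 bounds the integral of
    [gamma]: $2\,CG$ from the constant on an interval of length 2, and $CG$ from the top
    derivative. *)
Lemma dfamily_leibniz : dfamily m (2 ^+ m * (CD * (3 * CG))) leibniz.
Proof.
have [g1 g2 g3 g4] := sG; have JN1 := @inJN1 R; have J1 := @inJ1 R.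
have igam : integ gamma by apply: integD; [exact: integ_cst|exact: integ_norm].
have two1 : 1 <= (2 : R) by rewrite ler1n.
split.
- by move=> p q t pm qm Jt; apply: w_AC_s => //; lia.
- by move=> p q s pm qm Js; apply: w_AC_t => //; lia.
- by move=> p q pm qm; apply: w_jint => //; lia.
- exists (fun t => 2 ^+ m * (CD * gamma t)); split.
  + by apply: integZ; apply: integZ.
  + rewrite itgZ //; last exact: integZ.
    rewrite itgZ // ler_wpM2l ?exprn_ge0 // ler_wpM2l //.
    rewrite /gamma itgD //; [|exact: integ_cst|exact: integ_norm].
    by rewrite itg_cst; [move: g4; lra|lra].
  + move=> p q s t pm qm Js Jt.
    apply: (@le_trans _ _ (2 ^+ q * (CD * gamma t))); first by apply: w_bnd => //; lia.
    apply: ler_wpM2r; last exact: ler_weXn2l.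
    by rewrite mulr_ge0 // addr_ge0.
- move=> p q s pm qm Js.
  apply: (@le_trans _ _ (2 ^+ q * (CD * CG))); first by apply: w_bnd1 => //; lia.
  apply: ler_pM; rewrite ?exprn_ge0 ?mulr_ge0 //; first by apply: ler_weXn2l => //; lia.
  by apply: ler_wpM2l => //; rewrite ler_peMl // ler1n.
Qed.

(** The limits are fixed and [s] enters only through the kernel, so all derivatives fall on [D]; an
    $L^1$ bound on [g] suffices. *)
Lemma tower_full (g : R -> R) (C : R) : integ g -> itg (-1) 1 (fun t => `|g t|) <= C ->
  tower m (CD * C) (fun s => itg (-1) 1 (fun t => D 0%N 0%N s t * g t)).
Proof.
move=> ig gC; have [k1 k2 k3] := kD; have JN1 := @inJN1 R; have J1 := @inJ1 R.
have jD a : (a <= m)%N -> jint (fun s t => D a 0%N s t * g t).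
  move=> am; apply: jint_ext (jint_mul (k3 a 0%N am isT)
    (jint_prod (integ_cst (1 : R)) ig)) => x y _ _.
  by rewrite mul1r.
exists (fun a s => itg (-1) 1 (fun t => D a 0%N s t * g t)); split => //.
  move=> a am; have [_ ia _] := jD a (ltnW am).
  apply: (@AC_square R (fun s t => D a 0%N s t * g t) (fun s t => D a.+1 0%N s t * g t)) => //.
    move=> t Jt; have := ACZ (g t) (k1 a 0%N t am isT Jt).
    by apply: AC_ext => s _; rewrite mulrC.
  exact: jD.
move=> a am; have ja := jD a am; have [iF _] := fubini_square ja; split.
  exact: integ_measurable iF.
move=> s Js; apply: (@le_trans _ _ (CD * itg (-1) 1 (fun t => `|g t|))); last exact: ler_wpM2l.
have ing := integ_norm ig.
rewrite -itgZ //; apply: norm_itg_le => //.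
- by case: ja => _ + _; exact.
- exact: integZ.
move=> t Jt; rewrite normrM ler_wpM2r //.
by have [_ ->] := k3 a 0%N am isT.
Qed.

End KernelTimesFunction.

(** * Jointly continuous functions and passage to the boundary *)

Section JointlyContinuous.
Variable R : realType.
Local Notation mu := (@lebesgue_measure R).
Local Notation J := (`[(-1 : R), 1]%classic).
Local Notation RR := (measurableTypeR R * measurableTypeR R)%type.
Local Notation JJ := (J `*` J : set RR).
Implicit Types (F : R -> R) (K : R -> R -> R) (a b c s t x y : R).

Definition jcont K : Prop := continuous (fun p : R * R => K p.1 p.2).

(** An open set of the plane is a countable union of open rectangles with rational endpoints. *)
Lemma open_measurable2 (O : set (R * R)) : open O -> measurable (O : set RR).
Proof.
move=> oO.
pose rect (q1 q2 q3 q4 : rat) : set (R * R) :=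
  `]ratr q1, ratr q2[%classic `*` `]ratr q3, ratr q4[%classic.
pose B q1 q2 q3 q4 := if `[< rect q1 q2 q3 q4 `<=` O >] then rect q1 q2 q3 q4 else set0.
have -> : O = \bigcup_q1 \bigcup_q2 \bigcup_q3 \bigcup_q4 B q1 q2 q3 q4.
  apply/seteqP; split => [[x y] Oxy|z [q1 _ [q2 _ [q3 _ [q4 _]]]]]; last first.
    by rewrite /B; case: asboolP => // H; exact: H.
  have [[U V] [/= nU nV] UVO] := oO _ Oxy.
  move/nbhs_ballP: nU => [e1 /= e10 xU]; move/nbhs_ballP: nV => [e2 /= e20 yV].
  have [q1] : exists q : rat, ratr q \in `]x - e1, x[ by apply: rat_in_itvoo; lra.
  have [q2] : exists q : rat, ratr q \in `]x, x + e1[ by apply: rat_in_itvoo; lra.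
  have [q3] : exists q : rat, ratr q \in `]y - e2, y[ by apply: rat_in_itvoo; lra.
  have [q4] : exists q : rat, ratr q \in `]y, y + e2[ by apply: rat_in_itvoo; lra.
  rewrite !in_itv /= => /andP[h1 h2] /andP[h3 h4] /andP[h5 h6] /andP[h7 h8].
  exists q1 => //; exists q2 => //; exists q3 => //; exists q4 => //.
  rewrite /B; case: asboolP => [_|]; first by split; rewrite /= in_itv /=; apply/andP.
  case; move=> [x' y'] [] /=; rewrite !in_itv /= => /andP[i1 i2] /andP[i3 i4].
  by apply: UVO; split => /=; [apply: xU|apply: yV];
    rewrite /ball /= ltr_norml; apply/andP; split; lra.
do 4 (apply: bigcupT_measurable_rat => ?).
by rewrite /B; case: asboolP => // _; apply: measurableX.
Qed.

Lemma jcont_measurable K : jcont K -> measurable_fun setT (fun z : RR => K z.1 z.2).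
Proof.
move=> /continuousP cK; apply: (measurability _ (RGenOpens.measurableE R)).
move=> _ [_ [a [b ->] <-]]; rewrite setTI; apply: open_measurable2.
exact/cK/interval_open.
Qed.

Lemma jcont_swap K : jcont K -> jcont (fun x y => K y x).
Proof.
move=> cK p; apply: (@continuous_comp _ _ _ (fun p : R * R => (p.2, p.1))
  (fun p : R * R => K p.1 p.2)); last exact: cK.
by apply: (@cvg_pair _ _ _ _ (nbhs p.2) (nbhs p.1)); [exact: cvg_snd|exact: cvg_fst].
Qed.

Lemma jcont_section K x : jcont K -> continuous (K x).
Proof.
move=> cK y; apply: (@continuous_comp _ _ _ (fun y : R => (x, y))
  (fun p : R * R => K p.1 p.2)); last exact: cK.
by apply: (@cvg_pair _ _ _ _ (nbhs x) (nbhs y)); [exact: cvg_cst|exact: cvg_id].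
Qed.

Lemma jcont_jmeas K c : jcont K -> (forall x y, `|K x y| <= c) -> jmeas K c.
Proof. by move=> cK bK; split => //; apply: measurable_funTS; exact: jcont_measurable. Qed.

Lemma continuous_integ F : continuous F -> integ F.
Proof.
move=> cF; apply: continuous_compact_integrable; first exact: segment_compact.
exact: continuous_subspaceT.
Qed.

(** Dominated by the constant [c]. The interval $]-2,2[$ only serves as an open neighbourhood of
    $[-1,1]$, so that endpoints can be treated as interior points. *)
Lemma continuous_itg K c a b : jcont K -> (forall x y, `|K x y| <= c) ->
  inJ a -> inJ b -> {in `]-2, 2[, continuous (fun x => itg a b (K x))}.
Proof.
move=> cK bK Ja Jb x x2.
apply: (@continuity_under_integral R _ _ mu K `[a, b]%classic _ (-2) 2 _ _ (fun=> c)) => //.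
- by move=> y _; apply: integ_sub => //; apply: continuous_integ; exact: jcont_section.
- apply: aeW => y _ z _; exact: (jcont_section (jcont_swap cK)).
- by apply: (integ_sub Ja Jb); exact: integ_cst.
- by move=> y _; apply: aeW.
- by rewrite inE.
Qed.

(** Every [x] of the closed interval is a limit of points $x(1-e)$ with small $e>0$, which lie in
    the open one. *)
Lemma zero_closure F : {in `]-2, 2[, continuous F} ->
  (forall x, -1 < x -> x < 1 -> F x = 0) -> forall x, inJ x -> F x = 0.
Proof.
move=> cF F0 x [x1 x2]; apply/eqP/negPn/negP => Fx0.
have Fx : 0 < `|F x| by rewrite normr_gt0.
have /cF /cvgrPdist_lt/(_ _ Fx) : x \in `]-2, 2[ by rewrite in_itv /=; apply/andP; split; lra.
move=> /nbhs_ballP[d /= d0 xd].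
pose e := Num.min (d / 2) (1 / 2).
have e0 : 0 < e by rewrite lt_min; apply/andP; split; lra.
have ed : e <= d / 2 by rewrite ge_min lexx.
have e2 : e <= 1 / 2 by rewrite ge_min lexx orbT.
have : ball x d (x * (1 - e)).
  rewrite /ball /= (_ : x - x * (1 - e) = x * e); last by ring.
  rewrite normrM (gtr0_norm e0); apply: (@le_lt_trans _ _ (1 * e)); last by lra.
  by apply: ler_wpM2r; [exact: ltW|rewrite ler_norml x1 x2].
move=> /xd /=; rewrite (F0 (x * (1 - e))) ?subr0 ?ltxx //; nra.
Qed.

Lemma zero_primitive F : {in `]-2, 2[, continuous F} -> (forall s, inJ s -> itg (-1) s F = 0) ->
  forall x, inJ x -> F x = 0.
Proof.
move=> cF F0; apply: zero_closure => // x x1 x2.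
have cF' y : inJ y -> {for y, continuous F}.
  by move=> [y1 y2]; apply: cF; rewrite in_itv /=; apply/andP; split; lra.
have iF : integ F.
  apply: continuous_compact_integrable; first exact: segment_compact.
  by apply: continuous_in_subspaceT => y /set_mem /inJE; exact: cF'.
have [_ <-] := @continuous_FTC1_closed R F (-1) x 1 x2 iF x1 (cF' x (conj (ltW x1) (ltW x2))).
rewrite derive1E; have H : \forall y \near x, itg (-1) y F = cst 0 y.
  have x11 : x \in `]-1, 1[ by rewrite in_itv /= x1.
  near=> y; have : y \in `]-1, 1[ by near: y; exact: near_in_itvoo.
  by rewrite in_itv /= => /andP[/ltW y1 /ltW y2]; apply: F0.
by rewrite (near_eq_derive _ H) derive_cst.
Unshelve. all: end_near. Qed.

Lemma AC_rect K K1 t : inJ t -> (forall y, inJ y -> AC (K^~ y) (K1^~ y)) ->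
  (forall x, inJ x -> integ (K x)) -> jint K1 ->
  AC (fun x => itg (-1) t (K x)) (fun x => itg (-1) t (K1 x)).
Proof.
move=> Jt ACK iK jK1.
have ml : measurable_fun setT (fun y : R => (y <= t)%R%:R : R).
  apply: (measurable_comp (F := [set: bool]) (f := (fun b : bool => b%:R : R))) => //.
  exact: measurable_fun_ler.
have jm : jmeas (fun _ y : R => (y <= t)%R%:R : R) 1.
  split; last by move=> x y _ _; case: (y <= t); rewrite ?normr1 ?normr0.
  apply: measurable_funTS; apply: (measurableT_comp ml).
  exact: measurable_snd.
have E F : itg (-1) 1 (fun y => (y <= t)%R%:R * F y) = itg (-1) t F.
  rewrite -[RHS](itg_indic _ (@inJN1 R) Jt).
  by apply: eq_itg => y /andP[-> _].
apply: AC_ext (@AC_square R (fun x y => (y <= t)%R%:R * K x y)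
  (fun x y => (y <= t)%R%:R * K1 x y) _ _ (jint_mul jm jK1)) => [x _|x _|y Jy|x Jx].
- exact: E.
- exact: E.
- by apply: ACZ; exact: ACK.
- apply: (@integ_mul_bnd _ _ _ 1); last exact: iK.
    exact: measurable_funTS.
  by move=> y _; case: (y <= t); rewrite ?normr1 ?normr0.
Qed.

(** For fixed upper limit, both sides of the integral identity are continuous in the parameter [y],
    so it extends from the interior to $y=\pm1$. *)
Lemma AC_closure K K1 c : jcont K -> jcont K1 -> (forall x y, `|K1 x y| <= c) ->
  (forall y, -1 < y -> y < 1 -> AC (K y) (K1 y)) -> forall y, inJ y -> AC (K y) (K1 y).
Proof.
move=> cK cK1 bK1 ACK y Jy; split; first exact: continuous_integ (jcont_section cK1).
move=> s Js; apply/eqP; rewrite -subr_eq0; apply/eqP; move: y Jy.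
apply: zero_closure => [x x2|x x1 x2]; last first.
  by have [_ ->] := ACK x x1 x2; rewrite ?subrr.
have c1 z : continuous (K^~ z) by exact: (jcont_section (jcont_swap cK)).
apply: cvgB; first exact: c1.
by apply: cvgD; [exact: c1|exact: (continuous_itg cK1 bK1 (@inJN1 R) Js)].
Qed.

End JointlyContinuous.

(** * From $C^{[m]}(I^2)$ to integral identities *)

Section Kernels.
Variable R : realType.
Local Notation mu := (@lebesgue_measure R).
Local Notation J := (`[(-1 : R), 1]%classic).
Implicit Types (F : R -> R) (a b m : nat) (c s t x y : R).

(** The projection onto $[-1,1]$. Composing with it turns continuity within the square into
    continuity on the whole plane without changing values on the square. *)
Definition clamp x : R := Num.max (-1) (Num.min 1 x).

Lemma inJ_clamp x : inJ (clamp x).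
Proof.
rewrite /clamp; split; first by rewrite le_max lexx.
by rewrite ge_max ge_min lexx andbT; lra.
Qed.

Lemma clamp_id x : inJ x -> clamp x = x.
Proof. by move=> [x1 x2]; rewrite /clamp (min_idPr x2) (max_idPr x1). Qed.

Lemma continuous_clamp : continuous clamp.
Proof.
move=> x; rewrite /clamp; apply: (@continuous_max R R (cst (-1)) (Num.min 1)); first exact: cvg_cst.
by apply: (@continuous_min R R (cst 1) id); [exact: cvg_cst|exact: cvg_id].
Qed.

Lemma continuous_comp_clamp F : {within J, continuous F} -> continuous (F \o clamp).
Proof.
move=> cF x; have Jc y : J (clamp y) by apply/inJE; exact: inJ_clamp.
have cx : clamp y @[y --> x] --> within J (nbhs (clamp x)).
  move=> A wA; have := continuous_clamp wA.
  by apply: (@filterS _ (nbhs x) _ (fun y => J (clamp y) -> A (clamp y))) => y; apply.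
by apply: cvg_comp cx _; move/subspace_continuousP: cF => /(_ _ (Jc x)).
Qed.

Lemma jcont_clamp (E : R -> R -> R) :
  {within J `*` J, continuous (fun p : R * R => E p.1 p.2)} ->
  jcont (fun s t => E (clamp s) (clamp t)).
Proof.
move=> cE p; pose q := (clamp p.1, clamp p.2).
have JJc (r : R * R) : (J `*` J) (clamp r.1, clamp r.2).
  by split; apply/inJE; exact: inJ_clamp.
have Jq : (J `*` J) q by exact: JJc.
have cq : (fun p : R * R => (clamp p.1, clamp p.2)) r @[r --> p] --> within (J `*` J) (nbhs q).
  have cq' : (fun p : R * R => (clamp p.1, clamp p.2)) r @[r --> p] --> nbhs q.
    apply: (@cvg_pair _ _ _ _ (nbhs q.1) (nbhs q.2)).
      by apply: (@continuous_comp _ _ _ fst clamp p); [exact: cvg_fst|exact: continuous_clamp].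
    by apply: (@continuous_comp _ _ _ snd clamp p); [exact: cvg_snd|exact: continuous_clamp].
  move=> A wA; have := cq' _ wA.
  apply: (@filterS _ (nbhs p) _ (fun r => (J `*` J) (clamp r.1, clamp r.2) ->
    A (clamp r.1, clamp r.2))) => r; apply; exact: JJc.
have cEq : (fun p : R * R => E p.1 p.2) r @[r --> within (J `*` J) (nbhs q)] --> E q.1 q.2.
  by move/subspace_continuousP: cE => /(_ q Jq).
exact: cvg_comp cq cEq.
Qed.

(** Densities in [s] come from the fundamental theorem at interior [t] and then from [AC_closure].
    Densities in [t] come this way only for [a = 0], where the $t$-derivatives are given; the step
    from [a] to [a.+1] is the symmetry of mixed derivatives in integrated form. It differentiates in
    [s] the identity expressing $D_{a,b}(s,t)-D_{a,b}(s,-1)$ as the integral of $D_{a,b+1}(s,\cdot)$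
    over $[-1,t]$. *)
Lemma kernel_clamp m c (E : nat -> nat -> R -> R -> R) :
  (forall a b, (a <= m)%N -> (b <= m)%N ->
     {within J `*` J, continuous (fun p : R * R => E a b p.1 p.2)}) ->
  (forall b, (b < m)%N -> forall s t, Io s -> Io t ->
     is_derive t 1 (E 0%N b s) (E 0%N b.+1 s t)) ->
  (forall a b, (a < m)%N -> (b <= m)%N -> forall s t, Io s -> Io t ->
     is_derive s 1 (fun s' => E a b s' t) (E a.+1 b s t)) ->
  (forall a b s t, (a <= m)%N -> (b <= m)%N -> inJ s -> inJ t -> `|E a b s t| <= c) ->
  kernel m c (fun a b s t => E a b (clamp s) (clamp t)).
Proof.
move=> cE dEt dEs bE; set D := (X in kernel _ _ X).
have cD a b : (a <= m)%N -> (b <= m)%N -> jcont (D a b).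
  by move=> am bm; apply: jcont_clamp; exact: cE.
have bD a b x y : (a <= m)%N -> (b <= m)%N -> `|D a b x y| <= c.
  by move=> am bm; apply: bE => //; exact: inJ_clamp.
have inIo x : -1 < x -> x < 1 -> Io x by move=> x1 x2; rewrite /Io /= in_itv /= x1.
have near_clamp x : -1 < x -> x < 1 -> \near x, clamp x = x.
  move=> x1 x2; have x11 : x \in `]-1, 1[ by rewrite in_itv /= x1.
  near=> y; have : y \in `]-1, 1[ by near: y; exact: near_in_itvoo.
  by rewrite in_itv /= => /andP[/ltW y1 /ltW y2]; apply: clamp_id.
have cid x : -1 < x -> x < 1 -> clamp x = x.
  by move=> /ltW x1 /ltW x2; apply: clamp_id.
have ACs a b t : (a < m)%N -> (b <= m)%N -> inJ t ->
    AC (fun s => D a b s t) (fun s => D a.+1 b s t).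
  move=> am bm; move: t; apply: (@AC_closure R (fun t s => D a b s t) (fun t s => D a.+1 b s t) c).
  - by apply: jcont_swap; apply: cD => //; exact: ltnW.
  - by apply: jcont_swap; exact: cD.
  - by move=> x y; exact: bD.
  move=> t t1 t2; apply: AC_C1_interior => [||s s1 s2].
  - exact: (jcont_section (jcont_swap (cD a b (ltnW am) bm))).
  - exact: (jcont_section (jcont_swap (cD a.+1 b am bm))).
  apply: (@near_eq_is_derive _ _ _ (fun s => E a b s t)).
    by apply: filterS (near_clamp s s1 s2) => y ys; rewrite /D ys (cid t).
  by rewrite /D !cid //; apply: dEs => //; exact: inIo.
have ACt a b s : (a <= m)%N -> (b < m)%N -> inJ s -> AC (D a b s) (D a b.+1 s).
  elim: a s => [|a IHa] s am bm; move: s.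
    apply: (@AC_closure R _ _ c).
    - by apply: cD => //; exact: ltnW.
    - exact: cD.
    - by move=> x y; exact: bD.
    move=> s s1 s2; apply: AC_C1_interior => [||t t1 t2].
    - exact: (jcont_section (cD 0%N b am (ltnW bm))).
    - exact: (jcont_section (cD 0%N b.+1 am bm)).
    apply: (@near_eq_is_derive _ _ _ (E 0%N b s)).
      by apply: filterS (near_clamp t t1 t2) => y ys; rewrite /D ys (cid s).
    by rewrite /D !cid //; apply: dEt => //; exact: inIo.
  move=> s Js; have am' : (a <= m)%N by lia.
  split; first exact: continuous_integ (jcont_section (cD _ _ am bm)).
  move=> t Jt; apply/eqP; rewrite -subr_eq0; apply/eqP; move: s Js.
  have jD1 : jint (D a.+1 b.+1).
    have := jint_mul (jcont_jmeas (cD a.+1 b.+1 am bm) (fun x y => bD _ _ x y am bm))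
      (jint_prod (integ_cst (1 : R)) (integ_cst (1 : R))).
    by apply: jint_ext => x y _ _; rewrite !mulr1.
  have AC1 : AC (fun s => itg (-1) t (D a b.+1 s)) (fun s => itg (-1) t (D a.+1 b.+1 s)).
    apply: AC_rect => // [y Jy|x Jx]; first exact: ACs.
    exact: continuous_integ (jcont_section (cD _ _ am' bm)).
  have AC2 := ACB (ACs a b t am (ltnW bm) Jt) (ACs a b (-1) am (ltnW bm) (@inJN1 R)).
  have cDt y : continuous ((D a.+1 b)^~ y) by exact: (jcont_section (jcont_swap (cD _ _ am (ltnW bm)))).
  (* The defect of the wanted identity is continuous in [s], and its integral over each $[-1,s]$
     vanishes by the identity at level [a], taken at [s] and at $-1$. *)
  apply: zero_primitive => [x x2|s Js].
    apply: cvgB; first exact: cDt.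
    apply: cvgD; first exact: cDt.
    exact: (continuous_itg (cD _ _ am bm) (fun x y => bD _ _ x y am bm) (@inJN1 R) Jt).
  have JN1 := @inJN1 R.
  transitivity (itg (-1) s (fun s => (D a.+1 b s t - D a.+1 b s (-1)) - itg (-1) t (D a.+1 b.+1 s))).
    by apply: eq_itg => x _; ring.
  rewrite itgB //; [|exact: AC2.1|exact: AC1.1].
  have := AC2.2 s Js; have := AC1.2 s Js.
  have /= := (IHa s am' bm Js).2 t Jt; have /= := (IHa (-1) am' bm JN1).2 t Jt.
  lra.
split => // a b am bm; apply: jcont_jmeas; first exact: cD.
by move=> x y; exact: bD.
Unshelve. all: end_near. Qed.

Lemma norm_fst_cabs (z : cplx R) : `|z.1| <= cabs z.
Proof.
rewrite -sqrtr_sqr /cabs /cabs2 ler_wsqrtr // lerDl; exact: sqr_ge0.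
Qed.

Lemma norm_snd_cabs (z : cplx R) : `|z.2| <= cabs z.
Proof.
rewrite -sqrtr_sqr /cabs /cabs2 ler_wsqrtr // lerDr; exact: sqr_ge0.
Qed.

Lemma is_derive_component (pi : R * R -> R) (f : R -> R * R) x (df : R * R) :
  continuous pi -> (forall (k : R) z w, pi (k *: (z - w)) = k *: (pi z - pi w)) ->
  is_derive x 1 f df -> is_derive x 1 (pi \o f) (pi df).
Proof.
move=> cpi lpi [/cvg_ex[l fl] fdf].
have ldf : l = df by rewrite -fdf; apply/esym/cvg_lim; [exact: norm_hausdorff|exact: fl].
have fl' : h^-1 *: ((pi \o f) (h *: 1 + x) - (pi \o f) x) @[h --> 0^'] --> pi df.
  rewrite -ldf; have := @cvg_comp _ _ _ _ pi _ _ _ fl (cpi l).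
  by apply: cvg_trans; apply: near_eq_cvg; apply: nearW => h /=; rewrite lpi.
apply: DeriveDef; first by apply/cvg_ex; exists (pi df).
by apply/cvg_lim; [exact: norm_hausdorff|exact: fl'].
Qed.

Lemma kernel_of_Cm m c (L : R -> R -> cplx R) : Cm_le m L c ->
  exists Dr Di, [/\ kernel m c Dr, kernel m c Di &
    forall s t, inJ s -> inJ t -> L s t = (Dr 0%N 0%N s t, Di 0%N 0%N s t)].
Proof.
move=> [D [D0 [cD [dDt [dDs bD]]]]].
have comp (pi : R * R -> R) : continuous pi ->
    (forall (k : R) z w, pi (k *: (z - w)) = k *: (pi z - pi w)) ->
    (forall z, `|pi z| <= cabs z) ->
    kernel m c (fun a b s t => pi (D a b (clamp s) (clamp t))).
  move=> cpi lpi bpi.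
  apply: (@kernel_clamp m c (fun a b s t => pi (D a b s t))).
  - by move=> a b am bm p; apply: (cvg_comp _ _ (cD a b am bm p)); exact: cpi.
  - by move=> b bm s t s1 t1; apply: (@is_derive_component pi (D 0%N b s)) => //; exact: dDt.
  - move=> a b am bm s t s1 t1.
    by apply: (@is_derive_component pi (fun s => D a b s t)) => //; exact: dDs.
  - move=> a b s t am bm /inJE Js /inJE Jt; apply: (le_trans (bpi _)).
    exact: bD.
exists (fun a b s t => (D a b (clamp s) (clamp t)).1), (fun a b s t => (D a b (clamp s) (clamp t)).2).
split.
- by apply: comp => //; [move=> z; exact: cvg_fst|exact: norm_fst_cabs].
- by apply: comp => //; [move=> z; exact: cvg_snd|exact: norm_snd_cabs].
move=> s t Js Jt; rewrite !clamp_id // -surjective_pairing D0 //; exact/inJE.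
Qed.

End Kernels.

(** * Smooth functions and the flat exponential *)

Section SmoothFunctions.
Variable R : realType.
Implicit Types (f g : R -> R) (a b x y : R) (n k : nat).

Fixpoint ndiff n f : Prop :=
  if n is n'.+1 then (forall x, derivable f x 1) /\ ndiff n' (derive1 f) else True.

Lemma ndiff_smooth f : (forall n, ndiff n f) -> forall n x, derivable (derive1n n f) x 1.
Proof.
move=> ff n; elim: n f ff => [|n IHn] f ff x; first by have [] := ff 1%N.
by rewrite derive1Sn; apply: IHn => k; have [] := ff k.+1.
Qed.

Lemma ndiff_step n f g : (forall x, is_derive x 1 f (g x)) -> ndiff n g -> ndiff n.+1 f.
Proof.
move=> dfg ng; split; first by move=> x; have [] := dfg x.
have -> // : derive1 f = g.
by apply/funext => x; rewrite derive1E; have [_ ->] := dfg x.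
Qed.

Lemma ndiffS n f : ndiff n.+1 f -> ndiff n f.
Proof. by elim: n f => // n IHn f [df nf]; split => //; exact: IHn. Qed.

Lemma ndiff_derive n f x : ndiff n.+1 f -> is_derive x 1 f (derive1 f x).
Proof. by move=> [df _]; rewrite derive1E; apply: DeriveDef. Qed.

Lemma ndiffD n f g : ndiff n f -> ndiff n g -> ndiff n (fun x => f x + g x).
Proof.
elim: n f g => // n IHn f g nf ng.
apply: (@ndiff_step _ _ (fun x => derive1 f x + derive1 g x)).
  by move=> x; apply: is_deriveD; [exact: ndiff_derive nf|exact: ndiff_derive ng].
by apply: IHn; [case: nf|case: ng].
Qed.

Lemma ndiffM n f g : ndiff n f -> ndiff n g -> ndiff n (fun x => f x * g x).
Proof.
elim: n f g => // n IHn f g nf ng.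
apply: (@ndiff_step _ _ (fun x => f x * derive1 g x + g x * derive1 f x)).
  by move=> x; apply: is_deriveM; [exact: ndiff_derive nf|exact: ndiff_derive ng].
have [_ nf'] := nf; have [_ ng'] := ng.
by apply: ndiffD; apply: IHn => //; exact: ndiffS.
Qed.

Lemma ndiff_cst n (c : R) : ndiff n (fun=> c).
Proof.
elim: n c => // n IHn c; apply: (@ndiff_step _ _ (fun=> 0)).
exact: IHn.
Qed.

Lemma ndiff_affine n a b f : ndiff n f -> ndiff n (fun x => f (a * x + b)).
Proof.
elim: n f => // n IHn f nf.
apply: (@ndiff_step _ _ (fun x => derive1 f (a * x + b) * a)); last first.
  have [_ nf'] := nf; apply: ndiffM; last exact: ndiff_cst.
  exact: IHn.
move=> x; pose g y := a * y + b.
have dg : is_derive x 1 g a by exact: is_derive_affine.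
exact: (is_derive1_comp (ndiff_derive (g x) nf) dg).
Qed.

(* [bump_tail k] has derivative [bump_tail k.+2 - k * bump_tail k.+1], so every
   function of this family is smooth, including at [0]. *)
Definition bump_tail k x : R := if 0 < x then x^-1 ^+ k * expR (- x^-1) else 0.

Lemma bump_tail_ge0 k x : 0 <= bump_tail k x.
Proof.
rewrite /bump_tail; case: ifP => // x0; rewrite mulr_ge0 ?expR_ge0 // exprn_ge0 //.
by rewrite invr_ge0 ltW.
Qed.

(** From $e^y\ge y^{k+2}/(k+2)!$ at $y=1/x$. The square makes the difference quotient at $0$ tend to
    $0$. *)
Lemma bump_tail_le k x : bump_tail k x <= x ^+ 2 * (k.+2)`!%:R.
Proof.
rewrite /bump_tail; case: ifPn => [x0|_]; last by rewrite mulr_ge0 ?sqr_ge0.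
have y0 : 0 <= x^-1 by rewrite invr_ge0 ltW.
have H : (x^-1) ^+ k.+2 <= (k.+2)`!%:R * expR x^-1.
  have f0 : 0 < (k.+2)`!%:R :> R by rewrite ltr0n fact_gt0.
  rewrite mulrC -ler_pdivrMr //; apply: le_trans (expR_ge1Dxn k.+1 y0).
  by rewrite lerDr.
rewrite expRN ler_pdivrMr ?expR_gt0 //.
have -> : x^-1 ^+ k = x ^+ 2 * (x^-1) ^+ k.+2.
  by rewrite -(addn2 k) exprD mulrCA -exprMn divff ?expr1n ?mulr1 // gt_eqF.
by rewrite -[leRHS]mulrA; apply: ler_wpM2l => //; exact: sqr_ge0.
Qed.

Lemma is_derive_bump_tail k x :
  is_derive x 1 (bump_tail k) (bump_tail k.+2 x - k%:R * bump_tail k.+1 x).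
Proof.
case: (ltgtP x 0) => [x0|x0|->].
- rewrite /bump_tail !ltNge (ltW x0) /= mulr0 subrr.
  apply: (@near_eq_is_derive _ _ _ (cst 0)).
  by apply: filterS (lt_nbhsl x0) => y y0; rewrite /= ltNge (ltW y0).
- have xn0 : x != 0 by rewrite gt_eqF.
  have dV : is_derive x 1 (fun y : R => y^-1) (- x ^- 2).
    have := @is_deriveV R id x 1 1 xn0 (is_derive_id _ _).
    by rewrite /GRing.scale /= mulr1.
  pose g (y : R) := - y^-1.
  have dN : is_derive x 1 g (x ^- 2).
    by rewrite -[x ^- 2]opprK; exact: is_deriveN.
  have dE := is_derive1_comp (is_derive_expR (g x)) dN.
  have dX := is_deriveX k dV; rewrite exprfctE in dX.
  have := is_deriveM dX dE.
  have -> : bump_tail k.+2 x = x^-1 ^+ k.+2 * expR (- x^-1) by rewrite /bump_tail x0.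
  have -> : bump_tail k.+1 x = x^-1 ^+ k.+1 * expR (- x^-1) by rewrite /bump_tail x0.
  move=> dM.
  have E : x^-1 ^+ k *: (expR (- x^-1) * x ^- 2) +
     expR (- x^-1) *: ((k%:R * x^-1 ^+ k.-1) *: (- x ^- 2)) =
     x^-1 ^+ k.+2 * expR (- x^-1) - k%:R * (x^-1 ^+ k.+1 * expR (- x^-1)).
    rewrite /GRing.scale /= -exprVn; case: {dX dM}k => [|k] /=.
      by ring.
    by rewrite !exprS; ring.
  rewrite -E; apply: (@near_eq_is_derive _ _ _ (fun y => y^-1 ^+ k * expR (- y^-1))).
    by apply: filterS (lt_nbhsr x0) => y y0; rewrite /bump_tail y0.
have E0 j : bump_tail j 0 = 0 by rewrite /bump_tail ltxx.
rewrite !E0 mulr0 subr0.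
have q0 : h^-1 *: (bump_tail k (h *: 1 + 0) - bump_tail k 0) @[h --> 0^'] --> (0 : R).
  apply/cvgrPdist_lt => e e0; pose C : R := (k.+2)`!%:R.
  have C0 : 0 < C by rewrite ltr0n fact_gt0.
  have eC : 0 < e / C by rewrite divr_gt0.
  near=> h; rewrite E0 subr0 sub0r normrN addr0 /GRing.scale /= mulr1.
  have h0 : h != 0 by near: h; exact: nbhs_dnbhs_neq.
  have he : `|h| < e / C by near: h; apply: dnbhs0_lt.
  rewrite normrM normfV (ger0_norm (bump_tail_ge0 _ _)) ltr_pdivrMl ?normr_gt0 //.
  apply: (le_lt_trans (bump_tail_le _ _)); rewrite -[h ^+ 2]real_normK ?num_real //.
  rewrite expr2 -mulrA ltr_pM2l ?normr_gt0 //.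
  by rewrite -ltr_pdivlMr.
apply: DeriveDef; first by apply/cvg_ex; exists 0.
by apply/cvg_lim; [exact: norm_hausdorff|exact: q0].
Unshelve. all: end_near. Qed.

Lemma ndiff_bump_tail n k : ndiff n (bump_tail k).
Proof.
elim: n k => // n IHn k; apply: ndiff_step; first exact: is_derive_bump_tail.
apply: ndiffD => //.
have -> : (fun x => - (k%:R * bump_tail k.+1 x)) = (fun x => - k%:R * bump_tail k.+1 x).
  by apply/funext => x; rewrite mulNr.
by apply: ndiffM => //; exact: ndiff_cst.
Qed.

End SmoothFunctions.

(** * The du Bois-Reymond lemma *)

Section DuBoisReymond.
Variable R : realType.
Local Notation mu := (@lebesgue_measure R).
Local Notation J := (`[(-1 : R), 1]%classic).
Implicit Types (f g z : R -> R) (a b s t x y : R) (n k : nat).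

(** Smooth functions with values in $[0,1]$, zero outside $]a,b[$, which tend pointwise to the
    indicator of $]a,b[$ as [n] grows. *)
Definition bump n a b x : R :=
  bump_tail 0 (n.+1%:R * (x - a)) * bump_tail 0 (n.+1%:R * (b - x)).

Lemma ndiff_bump k n a b : ndiff k (bump n a b).
Proof.
have H c d : ndiff k (fun x => bump_tail 0 (c * x + d)).
  by apply: (@ndiff_affine R k c d (bump_tail 0)); exact: ndiff_bump_tail.
have -> : bump n a b = (fun x => bump_tail 0 (n.+1%:R * x + - (n.+1%:R * a)) *
                                 bump_tail 0 (- n.+1%:R * x + n.+1%:R * b)).
  by apply/funext => x; rewrite /bump; congr (bump_tail 0 _ * bump_tail 0 _); ring.
exact: ndiffM.
Qed.

Lemma bump_tail0_le1 x : bump_tail 0 x <= 1.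
Proof.
rewrite /bump_tail; case: ifP => // x0.
by rewrite expr0 mul1r expR_le1 oppr_le0 invr_ge0 ltW.
Qed.

Lemma bump_ge0 n a b x : 0 <= bump n a b x.
Proof. by rewrite mulr_ge0 ?bump_tail_ge0. Qed.

Lemma norm_bump n a b x : `|bump n a b x| <= 1.
Proof.
rewrite ger0_norm ?bump_ge0 //.
by apply: mulr_ile1; rewrite ?bump_tail_ge0 ?bump_tail0_le1.
Qed.

Lemma bump_out n a b x : x <= a \/ b <= x -> bump n a b x = 0.
Proof.
rewrite /bump /bump_tail; case=> h.
  by rewrite ltNge pmulr_rle0 ?ltr0n // subr_le0 h mul0r.
by rewrite [X in _ * X]ifN ?mulr0 // -leNgt pmulr_rle0 ?ltr0n // subr_le0.
Qed.

Lemma ndiff_continuous f : ndiff 1 f -> continuous f.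
Proof.
move=> [df _] x; apply: differentiable_continuous; exact/derivable1_diffP.
Qed.

Lemma continuous_bump n a b : continuous (bump n a b).
Proof. by apply: ndiff_continuous; exact: ndiff_bump. Qed.

Lemma bump_cvg a b x : a < x -> x < b -> bump n a b x @[n --> \oo] --> (1 : R).
Proof.
move=> ax xb.
have H y : 0 < y -> bump_tail 0 (n.+1%:R * y) @[n --> \oo] --> (1 : R).
  move=> y0.
  have -> : (fun n => bump_tail 0 (n.+1%:R * y)) = (fun n => expR (- (n.+1%:R^-1 * y^-1))).
    by apply/funext => n; rewrite /bump_tail pmulr_rgt0 ?ltr0n // y0 expr0 mul1r invfM.
  have : expR (- (n.+1%:R^-1 * y^-1)) @[n --> \oo] --> expR (- (0 * y^-1)).
    apply: continuous_cvg; first exact: continuous_expR.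
    by apply: cvgN; apply: cvgMl; exact: cvg_harmonic.
  by rewrite mul0r oppr0 expR0.
have : bump n a b x @[n --> \oo] --> (1 * 1 : R).
  by apply: cvgM; apply: H; rewrite subr_gt0.
by rewrite mulr1.
Qed.

Lemma itg0 a b : itg a b (fun=> 0) = 0 :> R.
Proof. by rewrite /itg Rintegral_cst // mul0r. Qed.

(** The zero mean makes the primitive vanish to the right of [b] as well as to the left of [a], so
    it has compact support in the open interval. *)
Lemma primitive_test g a b : -1 < a -> b < 1 -> (forall n, ndiff n g) ->
  (forall x, x <= a \/ b <= x -> g x = 0) -> itg (-1) 1 g = 0 ->
  test_fun (fun x => itg (-1) x g) /\ derive1 (fun x => itg (-1) x g) = g.
Proof.
move=> a1 b1 ng g0 ig0; have cg := ndiff_continuous (ng 1%N).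
have left0 y : y <= a -> itg (-1) y g = 0.
  move=> ya; rewrite -(itg0 (-1) y); apply: eq_itg => x /andP[_ xy].
  by apply: g0; left; exact: le_trans ya.
have right0 y : b < y -> itg (-1) y g = 0.
  move=> yb; rewrite -ig0 /itg [LHS]Rintegral_mkcond [RHS]Rintegral_mkcond.
  apply: eq_Rintegral => x _; rewrite !patchE.
  have -> : (x \in `[-1, y]%classic) = (-1 <= x <= y).
    by apply/idP/idP; rewrite inE /= in_itv.
  have -> : (x \in `[-1, 1]%classic) = (-1 <= x <= 1).
    by apply/idP/idP; rewrite inE /= in_itv.
  case: (leP b x) => bx; first by rewrite g0 ?if_same //; right.
  by rewrite (ltW (lt_trans bx yb)) (ltW (lt_trans bx b1)).
have dG x : is_derive x 1 (fun x => itg (-1) x g) (g x).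
  case: (ltP x a) => xa.
    rewrite (g0 x); last by left; exact: ltW.
    apply: (@near_eq_is_derive _ _ _ (cst 0)).
    by apply: filterS (lt_nbhsl xa) => y ya; rewrite /= left0 // ltW.
  have xx1 : x < x + 1 by rewrite ltrDl.
  have igx : mu.-integrable `[-1, x + 1] (EFin \o g).
    apply: continuous_compact_integrable; first exact: segment_compact.
    exact: continuous_subspaceT.
  have [d1 d2] := @continuous_FTC1_closed R g (-1) x (x + 1) xx1 igx (lt_le_trans a1 xa) (cg x).
  by rewrite -d2 derive1E; apply: DeriveDef.
split; last by apply/funext => x; rewrite derive1E; have [_ ->] := dG x.
split.
  by apply: ndiff_smooth => n; apply: ndiffS; exact: (ndiff_step dG (ng n)).
by exists a, b; split=> //; split=> // x [/ltW /left0|/right0].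
Qed.

(** Let [c] be the average of [z] weighted by a fixed bump [rho]. Any bump minus the multiple of
    [rho] with the same mass has zero mean, hence is the derivative of a test function; so $z-c$ is
    orthogonal to every bump. Letting bumps tend to indicators gives zero integral on all intervals.
    Stating the result through primitives avoids saying that $z=c$ almost everywhere. *)
Lemma du_bois_reymond z : integ z ->
  (forall phi, test_fun phi -> itg (-1) 1 (fun t => derive1 phi t * z t) = 0) ->
  exists c, forall s, inJ s -> itg (-1) s (fun t => z t - c) = 0.
Proof.
move=> iz tz; have JN1 := @inJN1 R; have J1 := @inJ1 R.
pose rho := bump 0 (- (1 / 2)) (1 / 2 : R); pose r := itg (-1) 1 rho.
have irho : integ rho by apply: continuous_integ; exact: continuous_bump.
have r0 : r != 0.
  apply/eqP => r0.
  have : rho 0 = 0.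
    apply: zero_primitive => [x _|s Js|]; last by split; lra.
      exact: continuous_bump.
    apply/le_anti/andP; split; last by apply: itg_ge0 => x _; exact: bump_ge0.
    rewrite -r0; apply: itg_le_full => //; first by case: Js.
    by move=> x _; exact: bump_ge0.
  have bt x : 0 < x -> bump_tail 0 x != 0.
    by move=> x0; rewrite /bump_tail x0 expr0 mul1r gt_eqF // expR_gt0.
  by apply/eqP; rewrite mulf_neq0 // bt // mul1r; lra.
have imul n a b f : integ f -> integ (fun t => bump n a b t * f t).
  apply: (@integ_mul_bnd _ _ _ 1); last by move=> x _; exact: norm_bump.
  by apply: measurable_funTS; apply: continuous_measurable_fun; exact: continuous_bump.
exists (itg (-1) 1 (fun t => rho t * z t) / r); set c := _ / r.
have izc : integ (fun t => z t - c) by apply: integB => //; exact: integ_cst.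
have bump0 n a b : -1 < a -> b < 1 -> itg (-1) 1 (fun t => bump n a b t * (z t - c)) = 0.
  move=> a1 b1; pose lam := itg (-1) 1 (bump n a b) / r.
  pose g x := bump n a b x - lam * rho x.
  have ib : integ (bump n a b) by apply: continuous_integ; exact: continuous_bump.
  have ng k : ndiff k g.
    rewrite (_ : g = (fun x => bump n a b x + - lam * rho x)); last first.
      by apply/funext => x; rewrite /g mulNr.
    apply: ndiffD; first exact: ndiff_bump.
    by apply: ndiffM; [exact: ndiff_cst|exact: ndiff_bump].
  have ig0 : itg (-1) 1 g = 0.
    rewrite itgB //; last exact: integZ.
    by rewrite itgZ // -/r /lam divfK // subrr.
  have [|||tg dg] := @primitive_test g (Num.min a (- (1 / 2))) (Num.max b (1 / 2)) _ _ ng _ ig0.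
  - by rewrite lt_min a1 /=; lra.
  - by rewrite gt_max b1 /=; lra.
  - move=> x [|]; rewrite ?le_min ?ge_max => /andP[h1 h2];
    by rewrite /g /rho !bump_out ?mulr0 ?subr0 //; (try by left); right.
  have := tz _ tg; rewrite dg.
  have -> : itg (-1) 1 (fun t => g t * z t) =
      itg (-1) 1 (fun t => bump n a b t * z t) - lam * itg (-1) 1 (fun t => rho t * z t).
    rewrite -itgZ //; last exact: imul.
    rewrite -itgB //; [|exact: imul|by apply: integZ; exact: imul].
    by apply: eq_itg => t _; rewrite /g; ring.
  move=> E; transitivity (itg (-1) 1 (fun t => bump n a b t * z t) - c * itg (-1) 1 (bump n a b)).
    rewrite -itgZ // -itgB //; [|exact: imul|exact: integZ].
    by apply: eq_itg => t _; ring.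
  by rewrite -E /lam /c; congr (_ - _); field.
have open0 a b : -1 < a -> a < b -> b < 1 -> itg a b (fun t => z t - c) = 0.
  move=> a1 ab b1; set w := fun t => z t - c.
  have Ja : inJ a by split; lra.
  have Jb : inJ b by split; lra.
  have iwc : mu.-integrable `[a, b] (EFin \o w) by exact: integ_sub.
  have iw : mu.-integrable `]a, b[ (EFin \o w).
    by apply: integrableS iwc => //; exact: subset_itv_oo_cc.
  have iwo : mu.-integrable `]a, b] (EFin \o w).
    by apply: integrableS iwc => //; apply: subset_itv; rewrite bnd_simp.
  rewrite /itg -(Rintegral_itv_obnd_cbnd iwo) -(Rintegral_itv_bndo_bndc iw).
  have mO : measurable (`]a, b[%classic : set (measurableTypeR R)) by [].
  have OJ : `]a, b[%classic `<=` J by apply: subset_itv; rewrite bnd_simp; lra.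
  have ibw n : mu.-integrable `]a, b[ (EFin \o (fun t => bump n a b t * w t)).
    by apply: integrableS (imul n a b w izc) => //; exact: measurableJ.
  have E n : (\int[mu]_(t in `]a, b[) (bump n a b t * w t)%:E = 0)%E.
    rewrite -[LHS]fineK; last exact: integrable_fin_num (ibw n).
    congr EFin; rewrite -(bump0 n a b a1 b1).
    rewrite /itg -/(Rintegral mu `]a, b[ (fun t => bump n a b t * w t)).
    rewrite [LHS]Rintegral_mkcond [RHS]Rintegral_mkcond.
    apply: eq_Rintegral => x _; rewrite !patchE.
    case: ifPn => [|]; first by rewrite inE => xO; rewrite mem_set //; exact: OJ.
    rewrite notin_setE /= in_itv /= => /negP; rewrite negb_and -!leNgt => /orP xab.
    by rewrite bump_out ?mul0r ?if_same.
  (* The bumps are at most 1 in modulus, so $|w|$ dominates, and the integrals, all zero, converge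
     to the integral of [w]. *)
  have [|||||_ _] := @dominated_convergence _ _ R mu `]a, b[%classic mO
    (fun n t => (bump n a b t * w t)%:E) (EFin \o w) (fun t => `|w t|%:E).
  - by move=> n; exact: measurable_int (ibw n).
  - exact: measurable_int iw.
  - apply: aeW => x; rewrite /= in_itv /= => /andP[ax xb].
    apply: cvg_EFin; first exact: nearW.
    have : bump n a b x * w x @[n --> \oo] --> 1 * w x.
      by apply: cvgMl; exact: bump_cvg.
    by rewrite mul1r.
  - exact: integrable_norm iw.
  - apply: aeW => x n _; rewrite lee_fin normrM.
    by rewrite ler_piMl // norm_bump.
  have -> : (fun n => \int[mu]_(t in `]a, b[) (bump n a b t * w t)%:E)%E = cst 0%E.
    by apply/funext => n; exact: E.
  move=> /(cvg_unique _ (cvg_cst _)) H.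
  by rewrite /Rintegral -H.
set w := fun t => z t - c; pose Z s := itg (-1) s w.
have ACZ : AC Z w by split => // s _; rewrite /Z itgxx add0r.
have Z0 x : -1 < x -> x < 1 -> Z x = Z 0.
  move=> x1 x2; have J0 : inJ (0 : R) by split; lra.
  have Jx : inJ x by split; lra.
  case: (ltgtP x 0) => [x0|x0|->//].
    rewrite (AC_itg ACZ Jx J0 (ltW x0)) open0 ?addr0 //; lra.
  by rewrite (AC_itg ACZ J0 Jx (ltW x0)) open0 ?addr0 //; lra.
(* So far the primitive is constant only on the open interval; continuity reaches the endpoints, in
   particular $-1$, where it vanishes. *)
have ZJ : forall x, inJ x -> Z (clamp x) - Z 0 = 0.
  apply: zero_closure => [x _|x x1 x2].
    apply: cvgB; last exact: cvg_cst.
    exact: (continuous_comp_clamp (AC_continuous ACZ)).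
  by rewrite clamp_id ?Z0 ?subrr //; split; exact: ltW.
move=> s Js; have := ZJ _ JN1; have := ZJ _ Js; rewrite !clamp_id //.
by rewrite {3}/Z itgxx -/(Z s); lra.
Qed.

End DuBoisReymond.

(** * Weak derivatives and absolutely continuous representatives *)

Section Sobolev.
Variable R : realType.
Local Notation J := (`[(-1 : R), 1]%classic).
Implicit Types (f g h z F : R -> R) (c s t x y : R) (m j : nat).

Lemma AC_test_fun (phi : R -> R) : test_fun phi ->
  [/\ AC phi (derive1 phi), phi (-1) = 0 & phi 1 = 0].
Proof.
move=> [dphi [a [b [a1 [b1 phi0]]]]].
have d0 x : derivable phi x 1 by exact: (dphi 0%N x).
have d1 x : derivable (derive1 phi) x 1 by exact: (dphi 1%N x).
split; [|by apply: phi0; left|by apply: phi0; right].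
apply: AC_C1 => x; first by rewrite derive1E; apply: DeriveDef.
by apply: differentiable_continuous; apply/derivable1_diffP.
Qed.

Lemma AC_derive1_test_fun (phi : R -> R) : test_fun phi ->
  AC (derive1 phi) (derive1n 2 phi).
Proof.
move=> [dphi _]; apply: AC_C1 => x.
  by rewrite derive1nS derive1E; apply: DeriveDef; first exact: (dphi 1%N x).
by apply: differentiable_continuous; apply/derivable1_diffP; exact: (dphi 2%N x).
Qed.

Lemma AC_weak_deriv F f (phi : R -> R) : AC F f -> test_fun phi ->
  itg (-1) 1 (fun t => derive1 phi t * F t) = - itg (-1) 1 (fun t => phi t * f t).
Proof.
move=> ACF /AC_test_fun[ACp p0 p1]; have [_ /(_ _ (@inJ1 R))] := AC_mul ACp ACF.
rewrite p0 p1 !mul0r add0r itgD; [|exact: inJN1|exact: inJ1| |].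
- by move/esym/eqP; rewrite addr_eq0 => /eqP.
- by apply: integ_ext (AC_integ_mul ACF ACp.1) => x _; rewrite mulrC.
- exact: AC_integ_mul ACp ACF.1.
Qed.

(** The difference of [f] and the primitive of [g] has zero weak derivative, so the du Bois-Reymond
    lemma applies to it. *)
Lemma AC_of_weak_deriv f g : integ f -> integ g ->
  (forall phi, test_fun phi ->
    itg (-1) 1 (fun t => derive1 phi t * f t) = - itg (-1) 1 (fun t => phi t * g t)) ->
  exists c, forall s, inJ s -> itg (-1) s f = itg (-1) s (fun t => c + itg (-1) t g).
Proof.
move=> intf intg fg; pose H t := itg (-1) t g; have JN1 := @inJN1 R; have J1 := @inJ1 R.
have ACH : AC H g by split => // s _; rewrite /H itgxx add0r.
have iH := AC_integ ACH.
have [phi tphi|c zc] := @du_bois_reymond R (fun t => f t - H t) (integB intf iH).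
  have [ACp _ _] := AC_test_fun tphi.
  have ACd := AC_derive1_test_fun tphi.
  transitivity (itg (-1) 1 (fun t => derive1 phi t * f t) - itg (-1) 1 (fun t => derive1 phi t * H t)).
    by rewrite -(itgB JN1 J1 (AC_integ_mul ACd intf) (AC_integ_mul ACd iH)); apply: eq_itg => t _; ring.
  by rewrite fg // (AC_weak_deriv ACH tphi) subrr.
exists c => s Js; apply/eqP; rewrite -subr_eq0 -itgB //; last first.
  by apply: integD => //; exact: integ_cst.
by rewrite -(zc s Js); apply/eqP; apply: eq_itg => t _; rewrite /H; ring.
Qed.

(** The zero function has density [z], and the product rule of [F] with it reads $0=\int Fz$. This
    replaces the argument that [z] vanishes almost everywhere. *)
Lemma itg_mul_null F f z : AC F f -> integ z -> (forall s, inJ s -> itg (-1) s z = 0) ->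
  forall s, inJ s -> itg (-1) s (fun t => F t * z t) = 0.
Proof.
move=> ACF iz z0 s Js; have JN1 := @inJN1 R.
have ACZ : AC (fun=> 0) z by split => // x Jx; rewrite z0 // addr0.
have [_ /(_ s Js)] := AC_mul ACF ACZ.
rewrite !mulr0 add0r => E; transitivity (itg (-1) s (fun x => f x * 0 + F x * z x)).
  by apply: eq_itg => t _; rewrite mulr0 add0r.
exact/esym.
Qed.

Lemma itg_mul_eq F f g h : AC F f -> integ g -> integ h ->
  (forall s, inJ s -> itg (-1) s g = itg (-1) s h) ->
  forall s, inJ s -> itg (-1) s (fun t => F t * g t) = itg (-1) s (fun t => F t * h t).
Proof.
move=> ACF ig ih gh s Js; have JN1 := @inJN1 R.
apply/eqP; rewrite -subr_eq0.
rewrite -(itgB JN1 Js (AC_integ_mul ACF ig) (AC_integ_mul ACF ih)); apply/eqP.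
rewrite -(itg_mul_null ACF (integB ig ih) _ Js) => [|x Jx].
  by apply: eq_itg => t _; ring.
by rewrite itgB // gh // subrr.
Qed.

(** The representative of [x j] for [j < m] is a constant plus the primitive of [x j.+1]; at order
    [m] it is [x m] itself. The constant is at most $2B$ and the primitive at most $B$, hence
    $3B$. *)
Lemma source_of_weak m (B : R) (x : nat -> R -> R) :
  (forall j, (j <= m)%N -> integ (x j)) ->
  (forall j, (j <= m)%N -> itg (-1) 1 (fun t => `|x j t|) <= B) ->
  (forall j, (j < m)%N -> forall phi, test_fun phi ->
    itg (-1) 1 (fun t => derive1 phi t * x j t) = - itg (-1) 1 (fun t => phi t * x j.+1 t)) ->
  exists G, source m (3 * B) G /\ forall s, inJ s -> itg (-1) s (x 0%N) = itg (-1) s (G 0%N).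
Proof.
move=> ix bx wx; have JN1 := @inJN1 R; have J1 := @inJ1 R.
have : forall j, exists c, (j < m)%N ->
    forall s, inJ s -> itg (-1) s (x j) = itg (-1) s (fun t => c + itg (-1) t (x j.+1)).
  move=> j; case: (ltnP j m) => jm; last by exists 0.
  by have [c cP] := AC_of_weak_deriv (ix j (ltnW jm)) (ix _ jm) (wx j jm); exists c.
move=> /choice[c cP].
pose G j t := if (j < m)%N then c j + itg (-1) t (x j.+1) else x j t.
have ACG j : (j < m)%N -> AC (G j) (x j.+1).
  move=> jm; split; first exact: ix.
  by move=> s Js; rewrite /G jm itgxx addr0.
have iG j : (j <= m)%N -> integ (G j).
  rewrite leq_eqVlt => /predU1P[->|jm]; last exact: AC_integ (ACG j jm).
  by rewrite /G ltnn; exact: ix.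
have Gx j s : (j <= m)%N -> inJ s -> itg (-1) s (x j) = itg (-1) s (G j).
  rewrite leq_eqVlt => /predU1P[->|jm] Js; last first.
    by rewrite (cP j jm s Js) /G; apply: eq_itg => t _; rewrite jm.
  by apply: eq_itg => t _; rewrite /G ltnn.
have bH j s : (j <= m)%N -> inJ s -> `|itg (-1) s (x j)| <= B.
  move=> jm Js; apply: le_trans (bx j jm); apply: norm_itg_le => //; first by case: Js.
    exact: ix.
  by apply: integ_norm; exact: ix.
(* Integrating the representation over $[-1,1]$ gives $2c_j=\int x_j-\int\!\int x_{j+1}$, where the
   right side is at most $B+2B$ in modulus. *)
have bc j : (j < m)%N -> `|c j| <= 2 * B.
  move=> jm; have h := cP j jm 1 J1.
  have iH : integ (fun t => itg (-1) t (x j.+1)).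
    by apply: (@AC_integ _ _ (x j.+1)); split; [exact: ix|move=> s _; rewrite itgxx add0r].
  rewrite itgD // in h; last exact: integ_cst.
  rewrite itg_cst in h; last by lra.
  have b1 := bH j 1 (ltnW jm) J1.
  have b2 : `|itg (-1) 1 (fun t => itg (-1) t (x j.+1))| <= B * (1 - -1).
    rewrite -itg_cst; last by lra.
    apply: norm_itg_le => //; first exact: integ_cst.
    by move=> t Jt; exact: bH.
  have -> : c j = (itg (-1) 1 (x j) - itg (-1) 1 (fun t => itg (-1) t (x j.+1))) / 2 by lra.
  rewrite normrM normfV normr_nat ler_pdivrMr ?ltr0n //.
  have B0 : 0 <= B := le_trans (normr_ge0 _) b1.
  by apply: (le_trans (ler_normB _ _)); lra.
exists G; split; last by move=> s Js; exact: Gx.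
split.
- move=> j jm; split; first exact: iG.
  by move=> s Js; rewrite -Gx // (ACG j jm).2.
- move=> j s jm Js; rewrite /G jm; apply: (le_trans (ler_normD _ _)).
  by have := bc j jm; have := bH j.+1 s jm Js; lra.
- exact: iG.
- have -> : itg (-1) 1 (fun t => `|G m t|) = itg (-1) 1 (fun t => `|x m t|).
    by apply: eq_itg => t _; rewrite /G ltnn.
  have := bx m (leqnn m).
  have : 0 <= itg (-1) 1 (fun t => `|x m t|) by apply: itg_ge0.
  lra.
Qed.

(** A substitute for Cauchy-Schwarz: integrated over $[-1,1]$ it bounds the $L^1$ norm of a
    component by $2+c^2$ when the $L^2$ norm is at most $c$. *)
Lemma abs_le_cabs2 (z : cplx R) : `|z.1| <= 1 + cabs2 z /\ `|z.2| <= 1 + cabs2 z.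
Proof.
rewrite /cabs2; have := sqr_ge0 (`|z.1| - 1); have := sqr_ge0 (`|z.2| - 1).
rewrite -[z.1 ^+ 2]real_normK ?num_real // -[z.2 ^+ 2]real_normK ?num_real //.
have := normr_ge0 z.1; have := normr_ge0 z.2.
by split; nra.
Qed.

Lemma source_of_Hm m c (u : R -> cplx R) : Hm_le m u c ->
  exists Gr Gi, [/\ source m (3 * (2 + c ^+ 2)) Gr, source m (3 * (2 + c ^+ 2)) Gi,
    [/\ integ (fun t => (u t).1), itg (-1) 1 (fun t => `|(u t).1|) <= 2 + c ^+ 2,
        integ (fun t => (u t).2) & itg (-1) 1 (fun t => `|(u t).2|) <= 2 + c ^+ 2] &
    forall s, inJ s -> itg (-1) s (fun t => (u t).1) = itg (-1) s (Gr 0%N) /\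
                       itg (-1) s (fun t => (u t).2) = itg (-1) s (Gi 0%N)].
Proof.
move=> [v [v0 [vL2 [vw vc]]]]; have JN1 := @inJN1 R; have J1 := @inJ1 R.
have i2 j : (j <= m)%N -> integ (fun t => 1 + cabs2 (v j t)).
  by move=> jm; have [_ [_ i]] := vL2 j jm; apply: integD => //; exact: integ_cst.
have bL2 j : (j <= m)%N -> itg (-1) 1 (fun t => 1 + cabs2 (v j t)) <= 2 + c ^+ 2.
  move=> jm; have [_ [_ i]] := vL2 j jm.
  rewrite itgD //; last exact: integ_cst.
  rewrite itg_cst; last by lra.
  rewrite (_ : 1 * (1 - -1) = 2); last by lra.
  rewrite lerD2l -[itg _ _ _]/(L2sq (v j)).
  have sum_ge0 k : 0 <= L2sq (v k).
    by apply: itg_ge0 => t _; rewrite /cabs2 addr_ge0 // sqr_ge0.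
  apply: (@le_trans _ _ (\sum_(j < m.+1) L2sq (v j))).
    rewrite (bigD1 (Ordinal (jm : (j < m.+1)%N))) //= lerDl.
    by apply: sumr_ge0 => k _; exact: sum_ge0.
  rewrite -[leLHS]sqr_sqrtr; last by apply: sumr_ge0 => k _; exact: sum_ge0.
  by apply: lerXn2r => //; rewrite nnegrE ?sqrtr_ge0 // (le_trans _ vc) ?sqrtr_ge0.
have comp (pi : cplx R -> R) : (forall w, `|pi w| <= 1 + cabs2 w) ->
    (forall j, (j <= m)%N -> measurable_fun J (fun t => pi (v j t))) ->
    (forall j, (j < m)%N -> forall phi, test_fun phi ->
      itg (-1) 1 (fun t => derive1 phi t * pi (v j t)) =
      - itg (-1) 1 (fun t => phi t * pi (v j.+1 t))) ->
    exists G, [/\ source m (3 * (2 + c ^+ 2)) G, integ (fun t => pi (u t)),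
      itg (-1) 1 (fun t => `|pi (u t)|) <= 2 + c ^+ 2 &
      forall s, inJ s -> itg (-1) s (fun t => pi (u t)) = itg (-1) s (G 0%N)].
  move=> bpi mpi wpi.
  have ipi j : (j <= m)%N -> integ (fun t => pi (v j t)).
    move=> jm; apply: (@le_integrable _ _ _ _ _ (@measurableJ R) _ _ _ _ (i2 j jm)).
      by apply/measurable_EFinP; exact: mpi.
    move=> t _; rewrite /= lee_fin [leRHS]ger0_norm; first exact: bpi.
    exact: le_trans (bpi (v j t)).
  have [||//|G [sG eG]] := @source_of_weak m (2 + c ^+ 2) (fun j t => pi (v j t)).
  - exact: ipi.
  - move=> j jm; apply: le_trans (bL2 j jm); apply: le_itg => //.
      by apply: integ_norm; exact: ipi.
    exact: i2.
  have uv t : inJ t -> v 0%N t = u t by move=> /inJE; exact: v0.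
  exists G; split => //.
  - by apply: integ_ext (ipi 0%N isT) => t Jt; rewrite uv.
  - apply: le_trans (bL2 0%N isT); apply: le_itg => //; last by move=> t /andP Jt; rewrite -uv.
      by apply: integ_norm; apply: integ_ext (ipi 0%N isT) => t Jt; rewrite uv.
    exact: i2.
  move=> s Js; rewrite -eG //; apply: eq_itg => t /andP[t1 ts].
  by rewrite uv //; case: Js => ? ?; split; lra.
have [||j jm phi tphi|Gr [r1 r2 r4 r3]] := comp fst.
- by move=> z; have [] := abs_le_cabs2 z.
- by move=> j jm; have [] := vL2 j jm.
- by have /(congr1 fst) := vw j jm phi tphi.
have [||j jm phi tphi|Gi [s1 s2 s4 s3]] := comp snd.
- by move=> z; have [] := abs_le_cabs2 z.
- by move=> j jm; have [_ []] := vL2 j jm.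
- by have /(congr1 snd) := vw j jm phi tphi.
by exists Gr, Gi; split => // s Js; rewrite r3 // s3.
Qed.

Definition ctower m (C : R) (F : R -> cplx R) : Prop :=
  tower m C (fun s => (F s).1) /\ tower m C (fun s => (F s).2).

(** Each squared modulus is at most $2C^2$ on an interval of length 2. Weak derivatives are obtained
    by integration by parts. *)
Lemma Hm_of_ctower m (C : R) (F : R -> cplx R) : ctower m C F ->
  Hm_le m F (Num.sqrt (\sum_(j < m.+1) 4 * C ^+ 2)).
Proof.
move=> [[v [v1 v2 v3]] [w [w1 w2 w3]]]; have JN1 := @inJN1 R; have J1 := @inJ1 R.
exists (fun j s => (v j s, w j s)).
have bcabs j : (j <= m)%N -> forall s, inJ s -> 0 <= cabs2 (v j s, w j s) <= 2 * C ^+ 2.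
  move=> jm s Js; have [_ /(_ s Js) bv] := v3 j jm; have [_ /(_ s Js) bw] := w3 j jm.
  have C0 : 0 <= C by exact: le_trans bv.
  rewrite /cabs2 /= addr_ge0 ?sqr_ge0 //= mulr_natl mulr2n.
  by apply: lerD; rewrite -[X in X <= _]real_normK ?num_real // lerXn2r ?nnegrE.
have icabs j : (j <= m)%N -> integ (fun s => cabs2 (v j s, w j s)).
  move=> jm; have [mv _] := v3 j jm; have [mw _] := w3 j jm.
  apply: (@integ_bnd _ _ (2 * C ^+ 2)).
    by apply: measurable_funD; apply: measurable_funX.
  by move=> s Js; have /andP[c0 c1] := bcabs j jm s Js; rewrite ger0_norm.
split; [|split; [|split]].
- by move=> t /inJE Jt; rewrite v1 // w1 // -surjective_pairing.
- move=> j jm; have [mv _] := v3 j jm; have [mw _] := w3 j jm.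
  by split; [|split]; [exact: mv|exact: mw|exact: icabs].
- move=> j jm phi tphi; apply/pair_equal_spec; split.
    exact: AC_weak_deriv (v2 j jm) tphi.
  exact: AC_weak_deriv (w2 j jm) tphi.
- apply: ler_wsqrtr; apply: ler_sum => j _.
  have jm : (j <= m)%N by have := ltn_ord j.
  rewrite /L2sq -[Rintegral _ _ _]/(itg (-1) 1 (fun t => cabs2 (v j t, w j t))).
  apply: (@le_trans _ _ (itg (-1) 1 (fun=> 2 * C ^+ 2))).
    apply: le_itg => //; [exact: icabs|exact: integ_cst|].
    by move=> x /andP Jx; have /andP[] := bcabs j jm x Jx.
  by rewrite itg_cst; [nra|lra].
Qed.

End Sobolev.

(** * Splitting one operator into amplitudes and waves *)

Section ComplexDecomposition.
Variable R : realType.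
Local Notation J := (`[(-1 : R), 1]%classic).
Local Notation C := (cplx R).
Implicit Types (k s t x om eps sg : R) (m : nat).

Lemma cplx_eq (z w : C) : z.1 = w.1 -> z.2 = w.2 -> z = w.
Proof. by case: z w => [a b] [c d] /= -> ->. Qed.

Lemma fstD (z w : C) : (z + w).1 = z.1 + w.1. Proof. by []. Qed.
Lemma sndD (z w : C) : (z + w).2 = z.2 + w.2. Proof. by []. Qed.
Lemma fstN (z : C) : (- z).1 = - z.1. Proof. by []. Qed.
Lemma sndN (z : C) : (- z).2 = - z.2. Proof. by []. Qed.
Definition cplxE := (fstD, sndD, fstN, sndN).

Ltac cring := apply: cplx_eq; rewrite ?cplxE /= ?cplxE /=; ring.

Lemma cmulC (z w : C) : cmul z w = cmul w z. Proof. by rewrite /cmul; cring. Qed.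
Lemma cmulA (x y z : C) : cmul x (cmul y z) = cmul (cmul x y) z.
Proof. by rewrite /cmul; cring. Qed.
Lemma cmulDr (x y z : C) : cmul x (y + z) = cmul x y + cmul x z.
Proof. by rewrite /cmul; cring. Qed.
Lemma cmul_regroup (l a b c d z : C) : cmul a b = cmul c d ->
  cmul l (cmul a (cmul b z)) = cmul c (cmul l (cmul d z)).
Proof.
by move=> abcd; rewrite (cmulA a) abcd -(cmulA c) (cmulA l) (cmulA c) (cmulC l).
Qed.

Lemma cexpiD (a b : R) : cexpi (a + b) = cmul (cexpi a) (cexpi b).
Proof. by rewrite /cexpi /cmul cosD sinD; cring. Qed.

Lemma cexpi0 : cexpi (0 : R) = (1, 0).
Proof. by rewrite /cexpi cos0 sin0. Qed.

Lemma cmul1 (z : C) : cmul z (1, 0) = z.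
Proof. by rewrite /cmul; cring. Qed.

Lemma cmul0 (z : C) : cmul 0 z = 0.
Proof. by rewrite /cmul; cring. Qed.

Lemma cAC_cos om phi s :
  AC (fun t => cos (om * (s - t) + phi)) (fun t => - (- om * sin (- om * t + (om * s + phi)))).
Proof.
apply: AC_ext (AC_cos_affine (- om) (om * s + phi)) => // t _.
by congr cos; ring.
Qed.

Lemma ctowerD m (K1 K2 : R) F G : ctower m K1 F -> ctower m K2 G ->
  ctower m (K1 + K2) (fun s => F s + G s).
Proof. by move=> [f1 f2] [g1 g2]; split; exact: towerD. Qed.

Lemma ctowerN m (K : R) F : ctower m K F -> ctower m K (fun s => - F s).
Proof. by move=> [f1 f2]; split; exact: towerN. Qed.

Lemma ctower0 m (K : R) : 0 <= K -> ctower m K (fun=> 0).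
Proof. by move=> K0; split; exact: tower0. Qed.

Lemma ctower_ge0 m (K : R) F : ctower m K F -> 0 <= K.
Proof.
move=> [[v [_ _ v3]] _]; have [_ /(_ _ (@inJ1 R))] := v3 0%N isT.
exact: le_trans.
Qed.

Lemma ctower_i m (K : R) F : ctower m K F -> ctower m K (fun s => (- (F s).2, (F s).1)).
Proof. by move=> [f1 f2]; split => //=; exact: towerN. Qed.

Definition decomp m (K om : R) (F : R -> C) : Prop :=
  exists w b, [/\ ctower m K w, ctower m K b &
    forall s, inJ s -> F s = w s + cmul (b s) (cexpi (om * s))].

Lemma decompD m (K1 K2 : R) om F G : decomp m K1 om F -> decomp m K2 om G ->
  decomp m (K1 + K2) om (fun s => F s + G s).
Proof.
move=> [w [b [tw tb Fw]]] [w' [b' [tw' tb' Gw]]].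
exists (fun s => w s + w' s), (fun s => b s + b' s).
split; [exact: ctowerD|exact: ctowerD|move=> s Js].
by rewrite Fw // Gw // /cmul; cring.
Qed.

Lemma decompN m (K : R) om F : decomp m K om F -> decomp m K om (fun s => - F s).
Proof.
move=> [w [b [tw tb Fw]]]; exists (fun s => - w s), (fun s => - b s).
split; [exact: ctowerN|exact: ctowerN|move=> s Js].
by rewrite Fw // /cmul; cring.
Qed.

Lemma decomp_i m (K : R) om F : decomp m K om F ->
  decomp m K om (fun s => (- (F s).2, (F s).1)).
Proof.
move=> [w [b [tw tb Fw]]].
exists (fun s => (- (w s).2, (w s).1)), (fun s => (- (b s).2, (b s).1)).
split; [exact: ctower_i|exact: ctower_i|move=> s Js].
by rewrite Fw // /cmul; cring.
Qed.

Lemma decomp_ext m (K : R) om F G : (forall s, inJ s -> F s = G s) ->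
  decomp m K om F -> decomp m K om G.
Proof.
by move=> FG [w [b [tw tb Fw]]]; exists w, b; split => // s Js; rewrite -FG // Fw.
Qed.

Definition volterra_exp om (f : R -> R -> R) s : C :=
  (itg (-1) s (fun t => cos (om * (s - t)) * f s t),
   itg (-1) s (fun t => sin (om * (s - t)) * f s t)).

(** The boundary sums of [volterra_cos] for cosine and sine have phases [om * s + psi j]; the
    addition formulas assemble them into one complex amplitude times $e^{i\omega s}$. [K] is fixed
    before [f] and [om]. *)
Lemma decomp_volterra_exp m (K0 : R) : (0 < m)%N -> exists K, forall f om,
  dfamily m K0 f -> om = 0 \/ 1 <= `|om| -> decomp m K om (volterra_exp om (f 0%N 0%N)).
Proof.
move=> m_gt0.
(* [A1] bounds the smooth part when [om] is large, [A2] the whole integral when [om] is zero, [A3]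
   the oscillating amplitude. *)
pose A1 := 2 ^+ m * (K0 + m%:R * (1 * K0)).
pose A2 := 2 ^+ m * (K0 + m%:R * (2 ^+ m * K0)) + m%:R * (2 ^+ m * (2 ^+ m * K0)).
pose A3 := m%:R * K0.
exists (A1 + A2 + A3) => f om famf om01.
have K00 : 0 <= K0 by exact: (dfamily_bound_ge0 m_gt0 famf).
have A10 : 0 <= A1 by rewrite /A1 !(mulr_ge0, addr_ge0, exprn_ge0, ler0n, ler01).
have A20 : 0 <= A2 by rewrite /A2 !(mulr_ge0, addr_ge0, exprn_ge0, ler0n, ler01).
have A30 : 0 <= A3 by rewrite /A3 mulr_ge0.
have A0 : 0 <= A1 + A2 + A3 by rewrite addr_ge0 // addr_ge0.
case: om01 => [->|om1].
  exists (fun s => (volterra (fun=> 1) (f) 0 0 s, 0)), (fun=> 0); split.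
  - split; last exact: tower0.
    by apply: tower_le (volterra_const m_gt0 famf); rewrite -/A2; lra.
  - exact: ctower0.
  move=> s _; rewrite cmul0 addr0; apply: cplx_eq => /=.
    by apply: eq_itg => t _; rewrite mul0r cos0.
  apply: etrans (itg0 (-1) s); apply: eq_itg => t _.
  by rewrite mul0r sin0 mul0r.
have [wc twc Ec] := volterra_cos m_gt0 famf 0 om1.
have [ws tws Es] := volterra_cos m_gt0 famf (- (pi / 2)) om1.
pose psi j := om - j.+1%:R * (pi / 2).
pose B (g : R -> R) s := \sum_(j < m) (om^-1 ^+ j.+1 * g (psi j)) * f 0%N j s (-1).
have tB g : (forall x, `|g x| <= 1) -> tower m A3 (B g).
  move=> bg.
  apply: (@tower_sum _ m m K0 (fun j s => (om^-1 ^+ j.+1 * g (psi j)) * f 0%N j s (-1))).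
  move=> j jm.
  apply: tower_le (towerZ (om^-1 ^+ j.+1 * g (psi j)) (tower_boundary famf jm)).
  rewrite ler_piMl // normrM normrX normfV mulr_ile1 // exprn_ile1 ?invr_ge0 //.
  by rewrite invf_le1 // (lt_le_trans ltr01).
exists (fun s => (wc s, ws s)), (fun s => (B cos s, B sin s)); split.
- by split; [apply: tower_le twc|apply: tower_le tws]; rewrite -/A1; lra.
- split; [apply: tower_le (tB cos _)|apply: tower_le (tB sin _)]; try lra.
    by move=> x; exact: cos_max.
  by move=> x; exact: sin_max.
move=> s Js; apply: cplx_eq; rewrite /cmul /=.
  transitivity (volterra (fun x => cos (om * x + 0)) f 0 0 s).
    by apply: eq_itg => t _; rewrite addr0.
  rewrite Ec; congr (_ + _); rewrite !mulr_suml -sumrB; apply: eq_bigr => j _.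
  by rewrite addr0 -/(psi j) cosD; ring.
transitivity (volterra (fun x => cos (om * x - pi / 2)) f 0 0 s).
  by apply: eq_itg => t _; rewrite cosBpihalf.
rewrite Es; congr (_ + _); rewrite !mulr_suml -big_split /=; apply: eq_bigr => j _.
have -> : om * s - pi / 2 + (om - j.+1%:R * (pi / 2)) = (om * s + psi j) - pi / 2.
  by rewrite /psi; ring.
by rewrite cosBpihalf sinD; ring.
Qed.

Definition cvolterra om (L : R -> R -> C) (u : R -> C) s : C :=
  cint `[-1, s] (fun t => cmul (L s t) (cmul (cexpi (om * (s - t))) (u t))).

Lemma AC_cos_conv om s : exists d, AC (fun t => cos (om * (s - t))) d.
Proof.
eexists; apply: AC_ext (cAC_cos om 0 s) => [t _|t _]; last by [].
by rewrite addr0.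
Qed.

Lemma AC_sin_conv om s : exists d, AC (fun t => sin (om * (s - t))) d.
Proof.
eexists; apply: AC_ext (cAC_cos om (- (pi / 2)) s) => [t _|t _]; last by [].
by rewrite cosBpihalf.
Qed.

(** Real and imaginary parts of [L] and [u] give four real products, each handled by
    [decomp_volterra_exp]; hence four copies of [K]. *)
Lemma decomp_cvolterra m (cL cu : R) : (0 < m)%N -> exists K, forall L u om,
  Cm_le m L cL -> Hm_le m u cu -> om = 0 \/ 1 <= `|om| ->
  decomp m K om (cvolterra om L u).
Proof.
move=> m_gt0; pose cG := 3 * (2 + cu ^+ 2).
have [K HK] := decomp_volterra_exp (2 ^+ m * (cL * (3 * cG))) m_gt0.
exists (K + K + (K + K)) => L u om CL Hu om01; have JN1 := @inJN1 R.
have [Dr [Di [kr ki LD]]] := kernel_of_Cm CL.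
have [Gr [Gi [sr si [ir _ ii _] uG]]] := source_of_Hm Hu.
have dE D G (kD : kernel m cL D) (sG : source m cG G) :=
  HK _ om (dfamily_leibniz m_gt0 kD sG) om01.
have dsum := decompD (decompD (dE _ _ kr sr) (decompN (dE _ _ ki si)))
  (decomp_i (decompD (dE _ _ kr si) (dE _ _ ki sr))).
apply: decomp_ext dsum => s Js.
have ACk D : kernel m cL D -> AC (D 0%N 0%N s) (D 0%N 1%N s).
  by move=> [_ k2 _]; apply: k2.
have ip (g : R -> R) D (x : R -> R) : (exists d, AC (fun t => g (om * (s - t))) d) -> kernel m cL D ->
    integ x -> integ (fun t => g (om * (s - t)) * (D 0%N 0%N s t * x t)).
  by move=> [d ACg] kD ix; exact: (AC_integ_mul ACg (AC_integ_mul (ACk D kD) ix)).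
(* A component of [u] may be replaced by its regular representative under the integral: both have
   the same primitives and are multiplied by an absolutely continuous function of [t]. *)
have eqp (g : R -> R) D (x : R -> R) G : (exists d, AC (fun t => g (om * (s - t))) d) ->
    kernel m cL D -> integ x -> source m cG G ->
    (forall s, inJ s -> itg (-1) s x = itg (-1) s (G 0%N)) ->
    itg (-1) s (fun t => g (om * (s - t)) * (D 0%N 0%N s t * G 0%N t)) =
    itg (-1) s (fun t => g (om * (s - t)) * (D 0%N 0%N s t * x t)).
  move=> [d ACg] kD ix sG xG.
  have iG := source_integ sG (leq0n m).
  have := itg_mul_eq (AC_mul ACg (ACk D kD)) ix iG xG Js.
  have assoc (y : R -> R) : itg (-1) s (fun t => g (om * (s - t)) * D 0%N 0%N s t * y t) =
      itg (-1) s (fun t => g (om * (s - t)) * (D 0%N 0%N s t * y t)).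
    by apply: eq_itg => t _; rewrite mulrA.
  by rewrite !assoc => ->.
have Ac := AC_cos_conv om s; have As := AC_sin_conv om s.
have ur s' : inJ s' -> itg (-1) s' (fun t => (u t).1) = itg (-1) s' (Gr 0%N) by move=> /uG[].
have ui s' : inJ s' -> itg (-1) s' (fun t => (u t).2) = itg (-1) s' (Gi 0%N) by move=> /uG[].
have Ls t : -1 <= t <= s -> L s t = (Dr 0%N 0%N s t, Di 0%N 0%N s t).
  by move=> /andP[t1 ts]; apply: LD => //; case: Js => ? ?; split; lra.
apply: cplx_eq; rewrite !cplxE /= ?cplxE /volterra_exp /leibniz /=.
  rewrite !(eqp cos _ _ _ Ac kr ir sr ur, eqp cos _ _ _ Ac ki ii si ui,
            eqp sin _ _ _ As kr ii si ui, eqp sin _ _ _ As ki ir sr ur).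
  have i1 := ip cos _ _ Ac kr ir; have i2 := ip cos _ _ Ac ki ii.
  have i3 := ip sin _ _ As kr ii; have i4 := ip sin _ _ As ki ir.
  rewrite -itgB // -itgD // -itgB //; [|exact: integB|exact: integD].
  by apply: eq_itg => t ts; rewrite Ls // /cmul /cexpi /=; ring.
rewrite !(eqp sin _ _ _ As kr ir sr ur, eqp sin _ _ _ As ki ii si ui,
          eqp cos _ _ _ Ac kr ii si ui, eqp cos _ _ _ Ac ki ir sr ur).
have i1 := ip sin _ _ As kr ir; have i2 := ip sin _ _ As ki ii.
have i3 := ip cos _ _ Ac kr ii; have i4 := ip cos _ _ Ac ki ir.
rewrite -itgB // -itgD // -itgD //; [|exact: integB|exact: integD].
by apply: eq_itg => t ts; rewrite Ls // /cmul /cexpi /=; ring.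
Qed.

Definition cAC (a : R -> C) : Prop :=
  (exists d, AC (fun t => (a t).1) d) /\ (exists d, AC (fun t => (a t).2) d).

Definition cinteg (g : R -> C) : Prop :=
  integ (fun t => (g t).1) /\ integ (fun t => (g t).2).

Lemma cintegD g h : cinteg g -> cinteg h -> cinteg (fun t => g t + h t).
Proof. by move=> [g1 g2] [h1 h2]; split; apply: integD. Qed.

Lemma cinteg_mul a g : cAC a -> cinteg g -> cinteg (fun t => cmul (a t) (g t)).
Proof.
move=> [[d1 a1] [d2 a2]] [g1 g2]; split => /=.
  by apply: integB; [exact: AC_integ_mul a1 g1|exact: AC_integ_mul a2 g2].
by apply: integD; [exact: AC_integ_mul a1 g2|exact: AC_integ_mul a2 g1].
Qed.

Lemma cAC_cexpi om phi : cAC (fun t => cexpi (om * t + phi)).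
Proof.
split; eexists => /=; first exact: AC_cos_affine.
apply: AC_ext (AC_cos_affine om (phi - pi / 2)) => [t _|t _]; last by [].
by rewrite addrA cosBpihalf.
Qed.

Lemma cint_ext a b g h : inJ a -> inJ b -> (forall t, inJ t -> g t = h t) ->
  cint `[a, b] g = cint `[a, b] h.
Proof.
move=> [a1 a2] [b1 b2] gh; rewrite /cint; congr (_, _); apply: eq_itg => t /andP[ta tb];
by rewrite gh //; split; lra.
Qed.

Lemma cintD a b g h : inJ a -> inJ b -> cinteg g -> cinteg h ->
  cint `[a, b] (fun t => g t + h t) = cint `[a, b] g + cint `[a, b] h.
Proof. by move=> Ja Jb [g1 g2] [h1 h2]; apply: cplx_eq; rewrite ?cplxE /=; apply: itgD. Qed.

Lemma cint_cmul a b (c : C) g : inJ a -> inJ b -> cinteg g ->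
  cint `[a, b] (fun t => cmul c (g t)) = cmul c (cint `[a, b] g).
Proof.
move=> Ja Jb [g1 g2]; rewrite /cmul /cint /=; congr (_, _).
  rewrite -[Rintegral _ _ _]/(itg a b (fun t => c.1 * (g t).1 - c.2 * (g t).2)).
  by rewrite itgB ?itgZ //; exact: integZ.
rewrite -[Rintegral _ _ _]/(itg a b (fun t => c.1 * (g t).2 + c.2 * (g t).1)).
by rewrite itgD ?itgZ //; exact: integZ.
Qed.

Lemma cint_split s g : inJ s -> cinteg g ->
  cint `[s, 1] g = cint `[-1, 1] g - cint `[-1, s] g.
Proof.
move=> [s1 s2] [g1 g2]; have JN1 := @inJN1 R; have J1 := @inJ1 R.
have s11 : -1 <= s <= 1 by apply/andP.
apply: cplx_eq; rewrite !cplxE /=.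
  have /= := itg_split JN1 J1 s11 g1; rewrite /itg => ->; ring.
have /= := itg_split JN1 J1 s11 g2; rewrite /itg => ->; ring.
Qed.

Lemma cAC_kernel m (c : R) L s : (0 < m)%N -> Cm_le m L c -> inJ s -> cAC (L s).
Proof.
move=> m_gt0 /kernel_of_Cm[Dr [Di [[_ kr _] [_ ki _] LD]]] Js; split; eexists.
  by apply: AC_ext (kr 0%N 0%N s isT m_gt0 Js) => // t Jt; rewrite LD.
by apply: AC_ext (ki 0%N 0%N s isT m_gt0 Js) => // t Jt; rewrite LD.
Qed.

Lemma cinteg_Hm m (c : R) u : Hm_le m u c -> cinteg u.
Proof. by move=> /source_of_Hm[? [? [_ _ [? _ ? _] _]]]. Qed.

(** The exponential depends on [t] alone and has modulus one, so it goes with [u] into the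
    integrable factor; no restriction on [om] arises. *)
Lemma ctower_full m (cL cu : R) : (0 < m)%N -> exists K, forall L u om,
  Cm_le m L cL -> Hm_le m u cu ->
  ctower m K (fun s => cint `[-1, 1] (fun t => cmul (L s t) (cmul (cexpi (om * t)) (u t)))).
Proof.
move=> m_gt0; pose M := 2 + cu ^+ 2; exists (cL * (M + M) + cL * (M + M)) => L u om CL Hu.
have JN1 := @inJN1 R; have J1 := @inJ1 R.
have [Dr [Di [kr ki LD]]] := kernel_of_Cm CL.
have [Gr [Gi [_ _ [ir br ii bi] _]]] := source_of_Hm Hu.
pose g t := cmul (cexpi (om * t)) (u t).
have [g1 g2] : cinteg g.
  apply: cinteg_mul (cinteg_Hm Hu).
  have [[d1 a1] [d2 a2]] := cAC_cexpi om 0.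
  by split; [exists d1; apply: AC_ext a1|exists d2; apply: AC_ext a2] => // t _; rewrite addr0.
have bg1 : itg (-1) 1 (fun t => `|(g t).1|) <= M + M.
  apply: (@le_trans _ _ (itg (-1) 1 (fun t => `|(u t).1| + `|(u t).2|))).
    apply: le_itg => //; [exact: integ_norm|apply: integD; exact: integ_norm|move=> t _].
    apply: (le_trans (ler_normB _ _)); rewrite !normrM.
    by apply: lerD; rewrite ler_piMl ?cos_max ?sin_max.
  by rewrite itgD //; [exact: lerD|exact: integ_norm|exact: integ_norm].
have bg2 : itg (-1) 1 (fun t => `|(g t).2|) <= M + M.
  apply: (@le_trans _ _ (itg (-1) 1 (fun t => `|(u t).1| + `|(u t).2|))).
    apply: le_itg => //; [exact: integ_norm|apply: integD; exact: integ_norm|move=> t _].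
    apply: (le_trans (ler_normD _ _)); rewrite !normrM addrC.
    by apply: lerD; rewrite ler_piMl ?cos_max ?sin_max.
  by rewrite itgD //; [exact: lerD|exact: integ_norm|exact: integ_norm].
have iD D (x : R -> R) s : kernel m cL D -> inJ s -> integ x -> integ (fun t => D 0%N 0%N s t * x t).
  by move=> [_ kD _] Js ix; exact: AC_integ_mul (kD 0%N 0%N s isT m_gt0 Js) ix.
split.
  apply: tower_ext (towerD (tower_full kr g1 bg1) (towerN (tower_full ki g2 bg2))) => s Js.
  rewrite -itgB ?iD //; [|exact: iD|exact: iD].
  by apply: eq_itg => t /andP Jt; rewrite LD.
apply: tower_ext (towerD (tower_full kr g2 bg2) (tower_full ki g1 bg1)) => s Js.
rewrite -itgD ?iD //; [|exact: iD|exact: iD].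
by apply: eq_itg => t /andP Jt; rewrite LD.
Qed.

Definition waves m (K k : R) (F : R -> C) : Prop :=
  exists w0 w1 w2, [/\ ctower m K w0, ctower m K w1, ctower m K w2 &
    forall s, inJ s ->
      F s = w0 s + cmul (w1 s) (cexpi (k * s)) + cmul (w2 s) (cexpi (- (k * s)))].

Lemma wavesD m (K1 K2 k : R) F G : waves m K1 k F -> waves m K2 k G ->
  waves m (K1 + K2) k (fun s => F s + G s).
Proof.
move=> [f0 [f1 [f2 [t0 t1 t2 FE]]]] [g0 [g1 [g2 [r0 r1 r2 GE]]]].
exists (fun s => f0 s + g0 s), (fun s => f1 s + g1 s), (fun s => f2 s + g2 s).
split; [exact: ctowerD|exact: ctowerD|exact: ctowerD|move=> s Js].
by rewrite FE // GE // /cmul; cring.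
Qed.

Lemma wavesN m (K k : R) F : waves m K k F -> waves m K k (fun s => - F s).
Proof.
move=> [f0 [f1 [f2 [t0 t1 t2 FE]]]].
exists (fun s => - f0 s), (fun s => - f1 s), (fun s => - f2 s).
split; [exact: ctowerN|exact: ctowerN|exact: ctowerN|move=> s Js].
by rewrite FE // /cmul; cring.
Qed.

Lemma waves_ext m (K k : R) F G : (forall s, inJ s -> F s = G s) ->
  waves m K k F -> waves m K k G.
Proof.
move=> FG [f0 [f1 [f2 [t0 t1 t2 FE]]]]; exists f0, f1, f2; split => // s Js.
by rewrite -FG // FE.
Qed.

Lemma waves_single m (K k sg : R) F : sg = 0 \/ sg = 1 \/ sg = -1 -> ctower m K F ->
  waves m K k (fun s => cmul (F s) (cexpi (sg * k * s))).
Proof.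
move=> sgE tF; have t0 := ctower0 m (ctower_ge0 tF).
case: sgE => [->|[->|->]].
- exists F, (fun=> 0), (fun=> 0); split => // s _.
  by rewrite !mul0r cexpi0 cmul1 !cmul0 !addr0.
- exists (fun=> 0), F, (fun=> 0); split => // s _.
  by rewrite mul1r cmul0 add0r addr0.
- exists (fun=> 0), (fun=> 0), F; split => // s _.
  by rewrite mulN1r mulNr cmul0 !add0r.
Qed.

(** The factor $e^{i\sigma ks}$ moves the frequencies $0$ and $(\varepsilon-\sigma)k$ to $\sigma k$
    and $\varepsilon k$, both among $0,\pm k$. *)
Lemma waves_shift m (K k eps sg : R) F : sg = 0 \/ sg = 1 \/ sg = -1 -> eps = 1 \/ eps = -1 ->
  decomp m K ((eps - sg) * k) F ->
  waves m (K + K) k (fun s => cmul (cexpi (sg * k * s)) (F s)).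
Proof.
move=> sgE epsE [w [b [tw tb FE]]].
have epsE' : eps = 0 \/ eps = 1 \/ eps = -1 by right.
apply: waves_ext (wavesD (waves_single k sgE tw) (waves_single k epsE' tb)) => s Js.
rewrite FE // cmulDr [in RHS]cmulC; congr (_ + _).
rewrite cmulA (cmulC _ (b s)) -cmulA -cexpiD; congr (cmul _ (cexpi _)); ring.
Qed.

Lemma cAC_cexpi_aff om phi (e : R -> R) : (forall t, e t = om * t + phi) ->
  cAC (fun t => cexpi (e t)).
Proof.
move=> eE; have -> : (fun t => cexpi (e t)) = (fun t => cexpi (om * t + phi)).
  by apply/funext => t; rewrite eE.
exact: cAC_cexpi.
Qed.

Definition op_at (e : bool) (k : R) (L1 L2 : R -> R -> C) (U : R -> C) s : C :=
  cint `[-1, s] (fun t => cmul (L1 s t) (cmul (cexpi (k * (s - t))) (U t)))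
  + ((-1) ^+ e) *: cint `[s, 1] (fun t => cmul (L2 s t) (cmul (cexpi (k * (t - s))) (U t))).

Lemma op_at_ext e k L1 L2 U V s : inJ s -> (forall t, inJ t -> U t = V t) ->
  op_at e k L1 L2 U s = op_at e k L1 L2 V s.
Proof.
move=> Js UV; have JN1 := @inJN1 R; have J1 := @inJ1 R.
by rewrite /op_at; congr (_ + _ *: _); apply: cint_ext => // t Jt; rewrite UV.
Qed.

Section AtFrequency.
Variables (m : nat) (cL : R).
Hypothesis m_gt0 : (0 < m)%N.

Lemma op_atD e k L1 L2 U V s : Cm_le m L1 cL -> Cm_le m L2 cL -> inJ s ->
  cinteg U -> cinteg V ->
  op_at e k L1 L2 (fun t => U t + V t) s = op_at e k L1 L2 U s + op_at e k L1 L2 V s.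
Proof.
move=> C1 C2 Js iU iV; have JN1 := @inJN1 R; have J1 := @inJ1 R.
have a1 := cAC_kernel m_gt0 C1 Js; have a2 := cAC_kernel m_gt0 C2 Js.
have e1 : cAC (fun t => cexpi (k * (s - t))).
  by apply: (@cAC_cexpi_aff (- k) (k * s)) => t; ring.
have e2 : cAC (fun t => cexpi (k * (t - s))).
  by apply: (@cAC_cexpi_aff k (- (k * s))) => t; ring.
have i1 W : cinteg W -> cinteg (fun t => cmul (L1 s t) (cmul (cexpi (k * (s - t))) (W t))).
  by move=> iW; apply: cinteg_mul => //; exact: cinteg_mul.
have i2 W : cinteg W -> cinteg (fun t => cmul (L2 s t) (cmul (cexpi (k * (t - s))) (W t))).
  by move=> iW; apply: cinteg_mul => //; exact: cinteg_mul.
rewrite /op_at.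
have -> : (fun t => cmul (L1 s t) (cmul (cexpi (k * (s - t))) (U t + V t))) =
  (fun t => cmul (L1 s t) (cmul (cexpi (k * (s - t))) (U t)) +
            cmul (L1 s t) (cmul (cexpi (k * (s - t))) (V t))).
  by apply/funext => t; rewrite !cmulDr.
have -> : (fun t => cmul (L2 s t) (cmul (cexpi (k * (t - s))) (U t + V t))) =
  (fun t => cmul (L2 s t) (cmul (cexpi (k * (t - s))) (U t)) +
            cmul (L2 s t) (cmul (cexpi (k * (t - s))) (V t))).
  by apply/funext => t; rewrite !cmulDr.
by rewrite !cintD; try solve [exact: i1|exact: i2|by []]; rewrite scalerDr addrACA.
Qed.

(** The integral over $[-1,s]$ is treated with $\varepsilon=1$. The integral over $[s,1]$ is the
    full integral, a wave of frequency $-k$, minus the integral over $[-1,s]$ with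
    $\varepsilon=-1$. *)
Lemma waves_op_at_single (cu : R) : exists K, forall e k sg L1 L2 u,
  1 < k -> sg = 0 \/ sg = 1 \/ sg = -1 ->
  Cm_le m L1 cL -> Cm_le m L2 cL -> Hm_le m u cu ->
  waves m K k (op_at e k L1 L2 (fun t => cmul (cexpi (sg * k * t)) (u t))).
Proof.
have [K1 HK1] := decomp_cvolterra cL cu m_gt0.
have [K2 HK2] := ctower_full cL cu m_gt0.
exists (K1 + K1 + (K2 + (K1 + K1))) => e k sg L1 L2 u k1 sgE C1 C2 Hu.
have JN1 := @inJN1 R; have J1 := @inJ1 R.
have k0 : 0 < k := lt_trans ltr01 k1.
(* The possible values are $0,\pm k,\pm2k$, and $k>1$ keeps the nonzero ones away from the interval
   where division by the frequency would be harmful. *)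
have om01 eps : eps = 1 \/ eps = -1 -> (eps - sg) * k = 0 \/ 1 <= `|(eps - sg) * k|.
  move=> epsE; have k1' : 1 <= k := ltW k1.
  case: epsE => ->; case: sgE => [->|[->|->]]; rewrite normrM (gtr0_norm k0).
  - by right; rewrite subr0 normr1 mul1r.
  - by left; rewrite subrr mul0r.
  - by right; rewrite opprK ger0_norm; [nra|lra].
  - by right; rewrite subr0 normrN1 mul1r.
  - by right; rewrite ler0_norm; [nra|lra].
  - by left; rewrite subrr mul0r.
have volE eps L s : (eps = 1 \/ eps = -1) -> Cm_le m L cL -> inJ s ->
    cint `[-1, s] (fun t => cmul (L s t)
      (cmul (cexpi (eps * k * (s - t))) (cmul (cexpi (sg * k * t)) (u t)))) =
    cmul (cexpi (sg * k * s)) (cvolterra ((eps - sg) * k) L u s).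
  move=> epsE CL Js; rewrite -cint_cmul //.
    apply: cint_ext => // t Jt; apply: cmul_regroup; rewrite -!cexpiD; congr cexpi; ring.
  apply: cinteg_mul; first exact: cAC_kernel CL Js.
  apply: cinteg_mul (cinteg_Hm Hu).
  by apply: (@cAC_cexpi_aff (- ((eps - sg) * k)) ((eps - sg) * k * s)) => t; ring.
have W1 L eps : eps = 1 \/ eps = -1 -> Cm_le m L cL ->
    waves m (K1 + K1) k (fun s => cint `[-1, s] (fun t => cmul (L s t)
      (cmul (cexpi (eps * k * (s - t))) (cmul (cexpi (sg * k * t)) (u t))))).
  move=> epsE CL; apply: waves_ext (waves_shift sgE epsE (HK1 _ _ _ CL Hu (om01 eps epsE))) => s Js.
  by rewrite volE.
have W2 : waves m K2 k (fun s => cint `[-1, 1] (fun t => cmul (L2 s t)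
      (cmul (cexpi (k * (t - s))) (cmul (cexpi (sg * k * t)) (u t))))).
  have sN : (-1 : R) = 0 \/ (-1 : R) = 1 \/ (-1 : R) = -1 by right; right.
  apply: waves_ext (waves_single k sN (HK2 L2 u ((1 + sg) * k) C2 Hu)) => s Js.
  rewrite cmulC -cint_cmul //.
    apply: cint_ext => // t Jt; apply/esym/cmul_regroup; rewrite -!cexpiD; congr cexpi; ring.
  apply: cinteg_mul; first exact: cAC_kernel C2 Js.
  apply: cinteg_mul (cinteg_Hm Hu).
  by apply: (@cAC_cexpi_aff ((1 + sg) * k) 0) => t; ring.
have N1 : (-1 : R) = 1 \/ (-1 : R) = -1 by right.
have P1 : (1 : R) = 1 \/ (1 : R) = -1 by left.
have W3 : waves m (K2 + (K1 + K1)) k (fun s => cint `[s, 1] (fun t => cmul (L2 s t)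
      (cmul (cexpi (k * (t - s))) (cmul (cexpi (sg * k * t)) (u t))))).
  apply: waves_ext (wavesD W2 (wavesN (W1 L2 (-1) N1 C2))) => s Js.
  rewrite cint_split //.
    congr (_ - _); apply: cint_ext => // t Jt.
    by congr (cmul _ (cmul (cexpi _) _)); ring.
  apply: cinteg_mul; first exact: cAC_kernel C2 Js.
  apply: cinteg_mul; first by apply: (@cAC_cexpi_aff k (- (k * s))) => t; ring.
  apply: cinteg_mul (cinteg_Hm Hu).
  by apply: (@cAC_cexpi_aff (sg * k) 0) => t; ring.
have W3' : waves m (K2 + (K1 + K1)) k (fun s => ((-1) ^+ e : R) *: cint `[s, 1] (fun t =>
    cmul (L2 s t) (cmul (cexpi (k * (t - s))) (cmul (cexpi (sg * k * t)) (u t))))).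
  case: e; last by apply: waves_ext W3 => s _; rewrite expr0 scale1r.
  by apply: waves_ext (wavesN W3) => s _; rewrite expr1 scaleN1r.
apply: waves_ext (wavesD (W1 L1 1 P1 C1) W3') => s Js.
by rewrite /op_at; congr (_ + _); apply: cint_ext => // t Jt; rewrite mul1r.
Qed.

Lemma waves_op_at (cu : R) : exists K, forall e k L1 L2 u0 u1 u2 U,
  1 < k -> Cm_le m L1 cL -> Cm_le m L2 cL ->
  Hm_le m u0 cu -> Hm_le m u1 cu -> Hm_le m u2 cu ->
  (forall t, inJ t ->
    U t = u0 t + cmul (u1 t) (cexpi (k * t)) + cmul (u2 t) (cexpi (- (k * t)))) ->
  waves m K k (op_at e k L1 L2 U).
Proof.
have [K HK] := waves_op_at_single cu.
exists (K + K + K) => e k L1 L2 u0 u1 u2 U k1 C1 C2 H0 H1 H2 UE.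
have s0 : (0 : R) = 0 \/ (0 : R) = 1 \/ (0 : R) = -1 by left.
have s1 : (1 : R) = 0 \/ (1 : R) = 1 \/ (1 : R) = -1 by right; left.
have sN : (-1 : R) = 0 \/ (-1 : R) = 1 \/ (-1 : R) = -1 by right; right.
have iu sg u : Hm_le m u cu -> cinteg (fun t => cmul (cexpi (sg * k * t)) (u t)).
  move=> Hu; apply: cinteg_mul (cinteg_Hm Hu).
  by apply: (@cAC_cexpi_aff (sg * k) 0) => t; rewrite addr0.
apply: waves_ext (wavesD (wavesD (HK e k 0 L1 L2 u0 k1 s0 C1 C2 H0)
  (HK e k 1 L1 L2 u1 k1 s1 C1 C2 H1)) (HK e k (-1) L1 L2 u2 k1 sN C1 C2 H2)) => s Js.
rewrite -op_atD //; [|exact: iu|exact: iu].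
rewrite -op_atD //; [|by apply: cintegD; exact: iu|exact: iu].
apply: op_at_ext => // t Jt; rewrite UE //.
by rewrite !mul0r cexpi0 cmulC cmul1 mul1r mulN1r mulNr !(cmulC (cexpi _)).
Qed.

End AtFrequency.
End ComplexDecomposition.

(** * Uniformity in $\kappa$ and closure of the space *)

Section Closure.
Variable R : realType.
Local Notation J := (`[(-1 : R), 1]%classic).
Implicit Types (c k : R) (m : nat).

Lemma Cm_le_mono m (L : R -> R -> cplx R) c c' : c <= c' -> Cm_le m L c -> Cm_le m L c'.
Proof.
move=> cc' [D [D0 [cD [dt [ds bD]]]]]; exists D; do 4 split => //.
by move=> a b s t am bm Is It; apply: le_trans cc'; exact: bD.
Qed.

Lemma Hm_le_mono m (u : R -> cplx R) c c' : c <= c' -> Hm_le m u c -> Hm_le m u c'.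
Proof.
move=> cc' [v [v0 [vL [vw vc]]]]; exists v; do 3 split => //; exact: le_trans cc'.
Qed.

Lemma L2_integ (f : R -> cplx R) : L2 f ->
  integ (fun t => (f t).1) /\ integ (fun t => (f t).2).
Proof.
move=> [m1 [m2 i2]].
have i1 : integ (fun t => 1 + cabs2 (f t)) by apply: integD => //; exact: integ_cst.
have dom (x : R -> R) : measurable_fun J x -> (forall t, `|x t| <= 1 + cabs2 (f t)) -> integ x.
  move=> mx bx; apply: (@le_integrable _ _ _ _ _ (@measurableJ R) _ _ _ _ i1).
    exact/measurable_EFinP.
  move=> t _; rewrite /= lee_fin [leRHS]ger0_norm; first exact: bx.
  exact: le_trans (bx t).
by split; apply: dom => // t; have [] := abs_le_cabs2 (f t).
Qed.

Lemma cabs2_ge0 (z : cplx R) : 0 <= cabs2 z.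
Proof. by rewrite addr_ge0 ?sqr_ge0. Qed.

Lemma cabs2D (z w : cplx R) : cabs2 (z + w) <= 2 * cabs2 z + 2 * cabs2 w.
Proof.
rewrite /cabs2 /=; have := sqr_ge0 (z.1 - w.1); have := sqr_ge0 (z.2 - w.2).
by nra.
Qed.

Lemma L2D (f g : R -> cplx R) : L2 f -> L2 g ->
  L2 (fun t => f t + g t) /\ L2sq (fun t => f t + g t) <= 2 * L2sq f + 2 * L2sq g.
Proof.
move=> [f1 [f2 i_f]] [g1 [g2 ig]]; have JN1 := @inJN1 R; have J1 := @inJ1 R.
have m1 : measurable_fun J (fun t => (f t + g t).1) by exact: measurable_funD.
have m2 : measurable_fun J (fun t => (f t + g t).2) by exact: measurable_funD.
have i2f := integZ 2 i_f; have i2g := integZ 2 ig; have i2 := integD i2f i2g.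
have isum : integ (fun t => cabs2 (f t + g t)).
  apply: (@le_integrable _ _ _ _ _ (@measurableJ R) _ _ _ _ i2).
    by apply/measurable_EFinP; apply: measurable_funD; apply: measurable_funX.
  move=> t _; rewrite /= lee_fin !ger0_norm ?cabs2_ge0 ?cabs2D //.
  by rewrite addr_ge0 // mulr_ge0 ?cabs2_ge0.
split; first by split; [|split].
rewrite /L2sq -[leLHS]/(itg (-1) 1 (fun t => cabs2 (f t + g t))).
apply: (@le_trans _ _ (itg (-1) 1 (fun t => 2 * cabs2 (f t) + 2 * cabs2 (g t)))).
  by apply: le_itg => // t _; exact: cabs2D.
by rewrite itgD // !itgZ.
Qed.

Lemma weak_derivD (f f' g g' : R -> cplx R) : L2 f -> L2 f' -> L2 g -> L2 g' ->
  weak_deriv f f' -> weak_deriv g g' ->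
  weak_deriv (fun t => f t + g t) (fun t => f' t + g' t).
Proof.
move=> /L2_integ If /L2_integ If' /L2_integ Ig /L2_integ Ig' wf wg phi tphi.
have JN1 := @inJN1 R; have J1 := @inJ1 R.
have [ACp _ _] := AC_test_fun tphi; have ACd := AC_derive1_test_fun tphi.
have scale (e d : R -> R) (x : R -> cplx R) : AC e d ->
    integ (fun t => (x t).1) /\ integ (fun t => (x t).2) -> cinteg (fun t => e t *: x t).
  by move=> ACe [x1 x2]; split; [exact: AC_integ_mul ACe x1|exact: AC_integ_mul ACe x2].
rewrite (_ : (fun t => derive1 phi t *: (f t + g t)) =
  (fun t => derive1 phi t *: f t + derive1 phi t *: g t)); last first.
  by apply/funext => t; rewrite scalerDr.
rewrite (_ : (fun t => phi t *: (f' t + g' t)) =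
  (fun t => phi t *: f' t + phi t *: g' t)); last first.
  by apply/funext => t; rewrite scalerDr.
rewrite [cint _ _](cintD JN1 J1 (scale _ _ _ ACd If) (scale _ _ _ ACd Ig)).
rewrite [in RHS](cintD JN1 J1 (scale _ _ _ ACp If') (scale _ _ _ ACp Ig')).
by have := wf phi tphi; have := wg phi tphi; rewrite /I => -> ->; rewrite opprD.
Qed.

(** The pointwise bound $|z+w|^2\le2|z|^2+2|w|^2$ takes the place of the triangle inequality, as
    only boundedness matters. *)
Lemma Hm_leD m (u v : R -> cplx R) c c' : Hm_le m u c -> Hm_le m v c' ->
  Hm_le m (fun t => u t + v t) (Num.sqrt (2 * c ^+ 2 + 2 * c' ^+ 2)).
Proof.
move=> [x [x0 [xL [xw xc]]]] [y [y0 [yL [yw yc]]]].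
have L2sq_ge0 (f : R -> cplx R) : 0 <= L2sq f.
  by apply: Rintegral_ge0 => t _; exact: cabs2_ge0.
have sum_le (f : nat -> R -> cplx R) d : Num.sqrt (\sum_(j < m.+1) L2sq (f j)) <= d ->
    \sum_(j < m.+1) L2sq (f j) <= d ^+ 2.
  move=> fd; rewrite -[leLHS]sqr_sqrtr ?sumr_ge0 //.
  by apply: lerXn2r => //; rewrite nnegrE ?sqrtr_ge0 // (le_trans _ fd) ?sqrtr_ge0.
exists (fun j t => x j t + y j t); split; [|split; [|split]].
- by move=> t It; rewrite x0 // y0.
- by move=> j jm; have [] := L2D (xL j jm) (yL j jm).
- by move=> j jm; have jm' := ltnW jm; apply: weak_derivD; auto.
apply: ler_wsqrtr; apply: (@le_trans _ _ (\sum_(j < m.+1) (2 * L2sq (x j) + 2 * L2sq (y j)))).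
  apply: ler_sum => j _; have jm : (j <= m)%N by have := ltn_ord j.
  by have [] := L2D (xL j jm) (yL j jm).
rewrite big_split /= -!mulr_sumr.
by apply: lerD; apply: ler_wpM2l => //; exact: sum_le.
Qed.

Lemma Hk0D m (u v : kfun R) : Hk0 m u -> Hk0 m v -> Hk0 m (fun k t => u k t + v k t).
Proof.
move=> [u1 [cu [ku [cu0 [ku0 uH]]]]] [v1 [cv [kv [cv0 [kv0 vH]]]]]; split.
  by move=> k k1; have [a Ha] := u1 k k1; have [b Hb] := v1 k k1; eexists; exact: Hm_leD Ha Hb.
exists (Num.sqrt (2 * cu ^+ 2 + 2 * cv ^+ 2)), (Num.max ku kv); split.
  by rewrite sqrtr_gt0 addr_gt0 // mulr_gt0 // exprn_gt0.
split; first by rewrite lt_max ku0.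
by move=> k k1; rewrite ge_max => /andP[kku kkv]; apply: Hm_leD; [exact: uH|exact: vH].
Qed.

Lemma tHk0D m (u v : kfun R) : tHk0 m u -> tHk0 m v -> tHk0 m (fun k t => u k t + v k t).
Proof.
move=> [u0 [u1 [u2 [h0 [h1 [h2 uE]]]]]] [v0 [v1 [v2 [g0 [g1 [g2 vE]]]]]].
exists (fun k t => u0 k t + v0 k t), (fun k t => u1 k t + v1 k t), (fun k t => u2 k t + v2 k t).
split; [exact: Hk0D|split; [exact: Hk0D|split; [exact: Hk0D|]]].
move=> k t k1 It; rewrite uE // vE //.
rewrite ![cmul (_ + _) _]cmulC !cmulDr ![cmul (cexpi _) _]cmulC.
by rewrite addrACA; congr (_ + _); rewrite addrACA.
Qed.

Lemma tHk0_of_waves m (u : kfun R) : (forall k, 1 < k -> exists K, waves m K k (u k)) ->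
  (exists K k0, 0 < k0 /\ forall k, 1 < k -> k0 <= k -> waves m K k (u k)) -> tHk0 m u.
Proof.
move=> uk [K [k0 [k00 uK]]].
(* One choice of amplitudes per [k] must serve both halves of [Hk0]. The condition
   [k0 <= k -> K' = K] makes the uniform constant available beyond [k0] and allows any constant
   before it. *)
have : forall k, exists w : (R -> cplx R) * (R -> cplx R) * (R -> cplx R), 1 < k ->
    (exists K', (k0 <= k -> K' = K) /\
      [/\ ctower m K' w.1.1, ctower m K' w.1.2 & ctower m K' w.2]) /\
    forall s, inJ s -> u k s = w.1.1 s + cmul (w.1.2 s) (cexpi (k * s)) +
                               cmul (w.2 s) (cexpi (- (k * s))).
  move=> k; case: (ltP 1 k) => k1; last by exists (cst 0, cst 0, cst 0).
  have [K' [K'K [w0 [w1 [w2 [t0 t1 t2 wE]]]]]] :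
      exists K', (k0 <= k -> K' = K) /\ waves m K' k (u k).
    case: (leP k0 k) => kk; first by exists K; split => //; exact: uK.
    by have [K' HK'] := uk k k1; exists K'.
  by exists (w0, w1, w2) => _; split => //; exists K'.
move=> /choice[w wP].
have HW (f : (R -> cplx R) * (R -> cplx R) * (R -> cplx R) -> R -> cplx R) :
    (forall k, 1 < k -> exists K', (k0 <= k -> K' = K) /\ ctower m K' (f (w k))) ->
    Hk0 m (fun k => f (w k)).
  move=> fw; split.
    by move=> k k1; have [K' [_ t]] := fw k k1; eexists; exact: Hm_of_ctower t.
  exists (Num.sqrt (\sum_(j < m.+1) 4 * K ^+ 2) + 1), k0; split.
    by rewrite ltr_wpDl ?sqrtr_ge0.
  split=> // k k1 kk; have [K' [/(_ kk) -> t]] := fw k k1.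
  by apply: Hm_le_mono (Hm_of_ctower t); rewrite lerDl.
exists (fun k => (w k).1.1), (fun k => (w k).1.2), (fun k => (w k).2).
split; [|split; [|split]].
- by apply: (HW (fun w => w.1.1)) => k k1; have [[K' [? [? ? ?]]] _] := wP k k1; exists K'.
- by apply: (HW (fun w => w.1.2)) => k k1; have [[K' [? [? ? ?]]] _] := wP k k1; exists K'.
- by apply: (HW (fun w => w.2)) => k k1; have [[K' [? [? ? ?]]] _] := wP k k1; exists K'.
by move=> k t k1 /inJE Jt; have [_ ->] := wP k k1.
Qed.

(** [waves_op_at] is used twice: with bounds depending on [k], for membership at each [k], and with
    the uniform bounds, beyond the largest of the five thresholds. *)
Lemma tHk0_opT m (o : opdata R) (u : kfun R) : (0 < m)%N -> inA m o ->
  tHk0 m u -> tHk0 m (opT o u).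
Proof.
move=> m_gt0 [[p1 [c1 [k1 [_ [k10 q1]]]]] [p2 [c2 [k2 [_ [k20 q2]]]]]].
move=> [u0 [u1 [u2 [[r0 [d0 [l0 [_ [l00 s0]]]]] [[r1 [d1 [l1 [_ [l10 s1]]]]]
  [[r2 [d2 [l2 [_ [l20 s2]]]]] uE]]]]]].
have uE' k : 1 < k -> forall t, inJ t -> u k t = u0 k t +
    cmul (u1 k t) (cexpi (k * t)) + cmul (u2 k t) (cexpi (- (k * t))).
  by move=> k_gt1 t /inJE Jt; exact: uE.
have step k cL1 cL2 e0 e1 e2 : Cm_le m (o.1.2 k) cL1 -> Cm_le m (o.2 k) cL2 ->
    Hm_le m (u0 k) e0 -> Hm_le m (u1 k) e1 -> Hm_le m (u2 k) e2 ->
    let cL := Num.max cL1 cL2 in let cu := Num.max e0 (Num.max e1 e2) in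
    [/\ Cm_le m (o.1.2 k) cL, Cm_le m (o.2 k) cL & [/\ Hm_le m (u0 k) cu,
        Hm_le m (u1 k) cu & Hm_le m (u2 k) cu]].
  move=> C1 C2 H0 H1 H2 cL cu; split; [| |split].
  - by apply: Cm_le_mono C1; rewrite le_max lexx.
  - by apply: Cm_le_mono C2; rewrite le_max lexx orbT.
  - by apply: Hm_le_mono H0; rewrite le_max lexx.
  - by apply: Hm_le_mono H1; rewrite !le_max lexx orbT.
  - by apply: Hm_le_mono H2; rewrite !le_max lexx !orbT.
apply: tHk0_of_waves.
  move=> k k_gt1; have [cL1 C1] := p1 k k_gt1; have [cL2 C2] := p2 k k_gt1.
  have [e0 H0] := r0 k k_gt1; have [e1 H1] := r1 k k_gt1; have [e2 H2] := r2 k k_gt1.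
  have [C1' C2' [H0' H1' H2']] := step k _ _ _ _ _ C1 C2 H0 H1 H2.
  have [K HK] := waves_op_at (Num.max cL1 cL2) m_gt0 (Num.max e0 (Num.max e1 e2)).
  by exists K; exact: (HK o.1.1 k _ _ _ _ _ _ k_gt1 C1' C2' H0' H1' H2' (uE' k k_gt1)).
have [K HK] := waves_op_at (Num.max c1 c2) m_gt0 (Num.max d0 (Num.max d1 d2)).
exists K, (Num.max (Num.max k1 k2) (Num.max l0 (Num.max l1 l2))); split.
  by rewrite !lt_max k10.
move=> k k_gt1; rewrite !ge_max => /and3P[/andP[kk1 kk2] kl0 /andP[kl1 kl2]].
have [C1' C2' [H0' H1' H2']] := step k _ _ _ _ _ (q1 k k_gt1 kk1) (q2 k k_gt1 kk2)
  (s0 k k_gt1 kl0) (s1 k k_gt1 kl1) (s2 k k_gt1 kl2).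
exact: (HK o.1.1 k _ _ _ _ _ _ k_gt1 C1' C2' H0' H1' H2' (uE' k k_gt1)).
Qed.

End Closure.

Theorem theorem4p4 (R : realType) (m n : nat) (hm : (0 < m)%N) (hn : (0 < n)%N)
  (T : nat -> opdata R) (hT : forall j, (0 < j)%N -> inA m (T j))
  (beta alpha : nat -> nat) (u : kfun R) :
  tHk0 m u -> tHk0 m (sumop T beta alpha n u).
Proof.
move=> tu.
have tprod a : tHk0 m (prodop T beta a u).
  (* The operators are known to lie in $\mathbb A$ for positive indices, which are the only ones in
     the product; this is carried through the induction on the list. *)
  have : all (fun j => (0 < j)%N) (iota 1 a).
    by apply/allP => j; rewrite mem_iota => /andP[].
  rewrite /prodop; elim: (iota 1 a) => //= j s IHs /andP[j0 /IHs tus].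
  by elim: (beta j) => //= b; exact/tHk0_opT/hT.
have sumE k : sumop T beta alpha k.+1 u =
    (fun kap s => sumop T beta alpha k u kap s + prodop T beta (alpha k.+1) u kap s).
  by apply/funext => kap; apply/funext => s; rewrite /sumop big_nat_recr.
case: n hn => // n _; elim: n => [|n IHn].
  have -> : sumop T beta alpha 1 u = prodop T beta (alpha 1%N) u.
    by apply/funext => kap; apply/funext => s; rewrite /sumop big_nat1.
  exact: tprod.
rewrite sumE; exact: tHk0D.
Qed.
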